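(* Consider a multi-layer directed network from the ML-ScBM with true numbers $(K_s,K_r)$ of sender and receiver communities, and suppose the null hypothesis $H_0:(K_s,K_r)=(K_{s0},K_{r0})$ holds. Suppose Assumptions 1–4 (stated in the context) hold, and let $\hat R$ be the normalized residual matrix built from the consistent label estimates $\hat g^s,\hat g^r$ returned by the community detection method $\mathcal M$ with inputs $(K_{s0},K_{r0})$. Let $\hat T_n=\sigma_1(\hat R)-2$. Then for every $\epsilon>0$, $\mathbb{P}(\hat T_n<\epsilon)\to1$ as $n\to\infty$.
   Context: ML-ScBM: $n$ nodes, $L\ge1$ layers, adjacency matrices $A^{(\ell)}\in\{0,1\}^{n\times n}$ with zero diagonal; sender labels $g^s\in\{1,\dots,K_s\}^n$, receiver labels $g^r\in\{1,\dots,K_r\}^n$ common to all layers; block matrices $B^{(\ell)}\in[0,1]^{K_s\times K_r}$. Entries $A^{(\ell)}(i,j)$, $i\ne j$, are independent Bernoulli with mean $\Omega^{(\ell)}(i,j)=B^{(\ell)}(g^s(i),g^r(j))$, and $\Omega^{(\ell)}(i,i)=0$. All quantities may depend on $n$; $K_{\max}=\max(K_s,K_r)$. Assumption 1: some $\delta\in(0,1/2)$ satisfies $\delta\le B^{(\ell)}(k,l)\le1-\delta$ for all $k,l,\ell$. Assumption 2: for some $c_0>0$, every sender community has at least $c_0n/K_s$ nodes and every receiver community has at least $c_0n/K_r$ nodes. Assumption 3: $K_{\max}^2L\log n/n\to0$. Assumption 4: the community detection method $\mathcal M$, applied to $\{A^{(\ell)}\}$ with inputs $(K_s,K_r)$,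 returns $\hat g^s,\hat g^r$ with $\mathbb P(\hat g^s=g^s)\to1$ and $\mathbb P(\hat g^r=g^r)\to1$ (equality up to permutation of labels). Construction of the test statistic for candidate $(K_{s0},K_{r0})$: apply $\mathcal M$ with inputs $(K_{s0},K_{r0})$ to get $\hat g^s\in\{1,\dots,K_{s0}\}^n$, $\hat g^r\in\{1,\dots,K_{r0}\}^n$; set $\hat B^{(\ell)}(k,l)=\frac{\sum_{i:\hat g^s(i)=k}\sum_{j:\hat g^r(j)=l}A^{(\ell)}(i,j)}{|\{i:\hat g^s(i)=k\}|\,|\{j:\hat g^r(j)=l\}|}$; $\hat\Omega^{(\ell)}(i,j)=\hat B^{(\ell)}(\hat g^s(i),\hat g^r(j))$ for $i\ne j$ and $\hat\Omega^{(\ell)}(i,i)=0$; $\hat R(i,i)=0$ and for $i\neq j$ \[\hat R(i,j)=\frac{\sum_{\ell}(A^{(\ell)}(i,j)-\hat\Omega^{(\ell)}(i,j))}{\sqrt{(n-1)\sum_\ell\hat\Omega^{(\ell)}(i,j)(1-\hat\Omega^{(\ell)}(i,j))}}.\] $\sigma_1$ is the largest singular value. *)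

(* Defs.v *)
From HB Require Import structures.
From mathcomp Require Import all_boot all_order all_algebra.
From mathcomp Require Import all_classical all_reals all_analysis.
Set Implicit Arguments. Unset Strict Implicit. Unset Printing Implicit Defensive.
Import Order.TTheory GRing.Theory Num.Theory.
Import numFieldNormedType.Exports.
Local Open Scope classical_set_scope.
Local Open Scope ring_scope.

(* A realization of the L-layer network on n nodes: layer l -> adjacency matrix *)
Notation config n L := {ffun 'I_L -> 'M[bool]_n}.

Section ML.
Variable R : realType.

Definition bern (p : R) (b : bool) : R := if b then p else 1 - p.

Definition Omega n L ks kr (B : 'I_L -> 'M[R]_(ks, kr))
  (gs : 'I_n -> 'I_ks) (gr : 'I_n -> 'I_kr) (l : 'I_L) (i j : 'I_n) : R :=
  if i == j then 0 else B l (gs i) (gr j).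

(* Probability of a configuration under the ML-ScBM: independent Bernoulli
   off-diagonal entries with means Omega, diagonal entries equal to 0 a.s. *)
Definition mlscbm_weight n L ks kr (B : 'I_L -> 'M[R]_(ks, kr))
  (gs : 'I_n -> 'I_ks) (gr : 'I_n -> 'I_kr) (A : config n L) : R :=
  \prod_(l < L) \prod_(i < n) \prod_(j < n)
     (if i == j then (~~ A l i j)%:R else bern (Omega B gs gr l i j) (A l i j)).

Definition mlscbm_prob n L ks kr (B : 'I_L -> 'M[R]_(ks, kr))
  (gs : 'I_n -> 'I_ks) (gr : 'I_n -> 'I_kr) (E : config n L -> Prop) : R :=
  \sum_(A : config n L | `[< E A >]) mlscbm_weight B gs gr A.

Definition eq_up_to_perm n a b (h : 'I_n -> 'I_a) (g : 'I_n -> 'I_b) : Prop :=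
  exists f : 'I_b -> 'I_a, bijective f /\ forall i, h i = f (g i).

Definition Bhat n L ks kr (A : config n L) (hs : 'I_n -> 'I_ks) (hr : 'I_n -> 'I_kr)
  (l : 'I_L) : 'M[R]_(ks, kr) :=
  \matrix_(k < ks, k' < kr)
    ((\sum_(i < n | hs i == k) \sum_(j < n | hr j == k') (A l i j)%:R)
      / (#|[set i | hs i == k]| * #|[set j | hr j == k']|)%:R).

Definition Omegahat n L ks kr (A : config n L) (hs : 'I_n -> 'I_ks)
  (hr : 'I_n -> 'I_kr) (l : 'I_L) (i j : 'I_n) : R :=
  if i == j then 0 else Bhat A hs hr l (hs i) (hr j).

Definition Rhat n L ks kr (A : config n L) (hs : 'I_n -> 'I_ks)
  (hr : 'I_n -> 'I_kr) : 'M[R]_n :=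
  \matrix_(i < n, j < n)
    (if i == j then 0 else
     (\sum_(l < L) ((A l i j)%:R - Omegahat A hs hr l i j))
      / Num.sqrt ((n.-1)%:R *
           \sum_(l < L) (Omegahat A hs hr l i j * (1 - Omegahat A hs hr l i j)))).

Definition sigma1 m p (M : 'M[R]_(m, p)) : R :=
  sup [set r : R | exists x : 'cV[R]_p,
         \sum_(j < p) x j 0 ^+ 2 = 1 /\
         r = Num.sqrt (\sum_(i < m) (M *m x) i 0 ^+ 2)].

End ML.

(* Main.v *)
(* Trace method.  With X the residual matrix normalised by the true means, the
   expected trace of (X^T X)^p is a sum over closed walks of mixed moments of
   independent centered Bernoulli variables (one edge per layer and ordered
   pair).  Rather than counting walk shapes, the walk is explored one step at a
   time, and the partial sums are dominated by theta^potential times a product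
   of moment bounds.  A step along a new edge contributes 1 + o(1) in total, a
   step closing an edge used exactly once contributes 1, and every other step
   is negligible, so the expected trace is at most n (2 + o(1))^(2p).  Taking p
   a power of two with p^8 of order n beats the factor n.  The estimation error
   is handled by second moments: the mean squared error of each block average
   is O(Kmax^2 / n^2), which makes the Frobenius distance between the empirical
   and the ideal residual matrices O(sqrt(Kmax^2 L / n)) in probability. *)

Require Import Defs.
From HB Require Import structures.
From mathcomp Require Import all_boot all_order all_algebra.
From mathcomp Require Import all_classical all_reals all_analysis.
From mathcomp Require Import zify ring lra.
Set Implicit Arguments. Unset Strict Implicit. Unset Printing Implicit Defensive.
Import Order.TTheory GRing.Theory Num.Theory.
Import numFieldNormedType.Exports.
Local Open Scope classical_set_scope.
Local Open Scope ring_scope.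

(** * Moments of products of random matrices *)

Section WalkMoments.
Variables (R : realType) (n : nat) (E S : finType).
Variables (P : S -> R) (y : E -> S -> R) (s : E -> R) (K tau : R) (N : nat).

Definition expect (h : S -> R) : R := \sum_(a : S) P a * h a.

(* The bound [v] for [m = 1] (where the moment is in fact 0) lets each step of
   a walk multiply the weight by a single factor, see [moment_ratio]. *)
Definition moment_bound (v : R) (m : nat) : R :=
  match m with 0 => 1 | 1 => v | m'.+2 => v * K ^+ m' end.

Definition moment_ratio (v : R) (m : nat) : R :=
  match m with 0 => v | 1 => 1 | _ => K end.

(** By independence a joint moment factors over edges; this product is the bound for a walk that has
    used each edge [e] exactly [c e] times. *)
Definition walk_weight (c : E -> nat) : R := \prod_e moment_bound (s e) (c e).

Definition incr (c : E -> nat) (e : E) : E -> nat := fun e' => (c e' + (e' == e))%N.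

Lemma incrE c e e' : incr c e e' = (c e' + (e' == e))%N. Proof. by []. Qed.

Definition monomial (c : E -> nat) (a : S) : R := \prod_e y e a ^+ c e.

(** Rows and columns are the two sides of a bipartite graph. Several edges may join the same two
    vertices, as the layers will, and exchanging [f] and [g] transposes the matrix. *)
Definition edge_matrix (f g : E -> 'I_n) (a : S) : 'M[R]_n :=
  \matrix_(i, j) \sum_(e | (f e == i) && (g e == j)) y e a.

Definition open_deg (f : E -> 'I_n) (c : E -> nat) (v : 'I_n) : nat :=
  #|[pred e | (f e == v) && (c e == 1%N)]|.

(* When a walk in a tree retraces its steps, the edges used exactly once form a
   path from the root to the current vertex: degree at most 1 at the current
   vertex and at most 2 elsewhere.  The potential measures the excess over these
   degrees; leaving a vertex along one of several open edges decreases it, which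
   pays for the choice of that edge. *)
Definition potential (f g : E -> 'I_n) (c : E -> nat) (i : 'I_n) : nat :=
  (open_deg f c i - 1 + \sum_(v | v != i) (open_deg f c v - 2)
   + \sum_v (open_deg g c v - 2))%N.

(* The terms come, in order, from steps along new edges, from new edges to a
   vertex that already has an open edge, from steps along open edges, and from
   third or later traversals. *)
Definition growth : R := n%:R * tau + N%:R ^+ 3 * tau + 1 + N%:R ^+ 2 * K.

Lemma moment_boundS v m : moment_bound v m.+1 = moment_ratio v m * moment_bound v m.
Proof. by case: m => [|[|m]] /=; rewrite ?mulr1 ?mul1r // exprS mulrCA. Qed.

Lemma walk_weight_incr c e :
  walk_weight (incr c e) = moment_ratio (s e) (c e) * walk_weight c.
Proof.
rewrite /walk_weight (bigD1 e) //= [in RHS](bigD1 e) //= incrE eqxx /= addn1.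
rewrite moment_boundS mulrA; congr (_ * _).
by apply: eq_bigr => e' /negbTE ne; rewrite incrE ne /= addn0.
Qed.

Lemma monomial_incr c e a : monomial (incr c e) a = y e a * monomial c a.
Proof.
rewrite /monomial (bigD1 e) //= [in RHS](bigD1 e) //= incrE eqxx /= addn1 exprS mulrA.
by congr (_ * _); apply: eq_bigr => e' /negbTE ne; rewrite incrE ne /= addn0.
Qed.

Lemma edge_matrix_tr f g a : (edge_matrix f g a)^T = edge_matrix g f a.
Proof. by apply/matrixP => i j; rewrite !mxE; apply: eq_bigl => e; rewrite andbC. Qed.

Lemma edge_matrix_mul f g a m (M : 'M[R]_(n, m)) i k :
  (edge_matrix f g a *m M) i k = \sum_(e | f e == i) y e a * M (g e) k.
Proof.
rewrite mxE (partition_big g xpredT) //=; apply: eq_bigr => j _.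
by rewrite mxE mulr_suml; apply: eq_bigr => e /andP[_ /eqP ->].
Qed.

Lemma sum_incr c e : (\sum_e' incr c e e' = (\sum_e' c e').+1)%N.
Proof.
under eq_bigr => e' _ do rewrite incrE.
have one : (\sum_e' (e' == e) = 1)%N.
  by rewrite (bigD1 e) //= eqxx big1 // => e' /negbTE ->.
by rewrite big_split /= one addn1.
Qed.

(** * Open degrees and the change of the potential in one step *)

Lemma open_degE f c v : open_deg f c v = (\sum_e ((f e == v) && (c e == 1)))%N.
Proof.
rewrite /open_deg -sum1_card big_mkcond /=; apply: eq_bigr => e _.
by rewrite inE; case: (_ && _).
Qed.

Lemma open_deg_le f c v : (open_deg f c v <= \sum_e c e)%N.
Proof.
by rewrite open_degE; apply: leq_sum => e _; case: eqP => //= _; case: (c e) => [|[]].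
Qed.

Lemma sum_open_deg f c : (\sum_v open_deg f c v <= \sum_e c e)%N.
Proof.
rewrite [leqRHS](partition_big f xpredT) //=; apply: leq_sum => v _.
rewrite open_degE [leqRHS]big_mkcond /=; apply: leq_sum => e _.
by case: (f e == v) => //=; case: (c e) => [|[]].
Qed.

Lemma open_deg_incr_neq f c e v : v != f e -> open_deg f (incr c e) v = open_deg f c v.
Proof.
move=> nv; apply: eq_card => e'; rewrite !inE incrE.
have [fe|//] := eqVneq (f e') v.
case: (eqVneq e' e) => [E0|_] /=; last by rewrite addn0.
by rewrite -fe E0 eqxx in nv.
Qed.

(** An edge opens when its count goes from 0 to 1 and closes from 1 to 2. The balance is additive
    because subtraction on naturals truncates. *)
Lemma open_deg_incr f c e :
  (open_deg f (incr c e) (f e) + (c e == 1%N) = open_deg f c (f e) + (c e == 0%N))%N.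
Proof.
rewrite !open_degE (bigD1 e) //= [in RHS](bigD1 e) //= incrE !eqxx /= addn1 eqSS.
have -> : (\sum_(e' | e' != e) ((f e' == f e) && (incr c e e' == 1)) =
           \sum_(e' | e' != e) ((f e' == f e) && (c e' == 1)))%N.
  by apply: eq_bigr => e' /negbTE ne; rewrite incrE ne /= addn0.
by case: (c e) => [|[|m]] /=; lia.
Qed.

(** Only the degrees at the two ends of [e] change. The walk now stands at [g e], so [f] and [g]
    swap: the allowance at [f e] rises from 1 to 2, that at [g e] falls from 2 to 1. *)
Lemma potential_incr f g c e :
  (potential g f (incr c e) (g e) + (open_deg f c (f e) - 1)
    + (open_deg g c (g e) - 2) =
  potential f g c (f e) + (open_deg f (incr c e) (f e) - 2)
    + (open_deg g (incr c e) (g e) - 1))%N.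
Proof.
rewrite /potential (bigD1 (f e) (F := fun v => (open_deg f (incr c e) v - 2)%N)) //=.
rewrite (bigD1 (g e) (F := fun v => (open_deg g c v - 2)%N)) //=.
have -> : (\sum_(v | v != g e) (open_deg g (incr c e) v - 2) =
           \sum_(v | v != g e) (open_deg g c v - 2))%N.
  by apply: eq_bigr => v nv; rewrite open_deg_incr_neq.
have -> : (\sum_(v | v != f e) (open_deg f (incr c e) v - 2) =
           \sum_(v | v != f e) (open_deg f c v - 2))%N.
  by apply: eq_bigr => v nv; rewrite open_deg_incr_neq.
set A := (\sum_(v | v != g e) _)%N; set B := (\sum_(v | v != f e) _)%N.
set A' := (X in (_ = _ + (_ + X) + _ + _)%N); set B' := (X in (_ = _ + X + _ + _ + _)%N).
have -> : A' = A by []; have -> : B' = B by [].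
lia.
Qed.

(** At [f e] degree and allowance both rise by one. At [g e] the degree rises while the allowance
    falls: an excess of at most 2, and none at a vertex without open edges. *)
Lemma potential_new f g c e : c e = 0%N ->
  (potential g f (incr c e) (g e) <=
   potential f g c (f e) + (0 < open_deg g c (g e)).*2)%N.
Proof.
move=> ce; have := potential_incr f g c e.
have := open_deg_incr f c e; have := open_deg_incr g c e; rewrite ce /=.
by case: (posnP (open_deg g c (g e))) => [->|]; lia.
Qed.

(** Closing [e] lowers the degree at both ends. At [g e] the allowance falls with it; at [f e] the
    allowance rises, so an excess there, present once two edges are open, shrinks. *)
Lemma potential_open f g c e : c e = 1%N ->
  (potential g f (incr c e) (g e) + (1 < open_deg f c (f e)) <=
   potential f g c (f e))%N.
Proof.
move=> ce; have := potential_incr f g c e.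
have := open_deg_incr f c e; have := open_deg_incr g c e; rewrite ce /=.
by case: ltnP; lia.
Qed.

(** No open degree changes; only the lower allowance on arrival can add one. *)
Lemma potential_old f g c e : (1 < c e)%N ->
  (potential g f (incr c e) (g e) <= (potential f g c (f e)).+1)%N.
Proof.
move=> ce; have := potential_incr f g c e.
have := open_deg_incr f c e; have := open_deg_incr g c e.
by case: (c e) ce => [|[|m]] //= _; lia.
Qed.

Hypothesis K_ge0 : 0 <= K.
Hypothesis s_ge0 : forall e, 0 <= s e.
Hypothesis N_gt0 : (0 < N)%N.
Hypothesis tau_ge0 : 0 <= tau.

Lemma walk_weight_ge0 c : 0 <= walk_weight c.
Proof.
apply: prodr_ge0 => e _; case: (c e) => [|[|m]] //=.
by rewrite mulr_ge0 ?exprn_ge0.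
Qed.

(** With [d] open edges at the departure vertex each is charged [1 / d]: for [d = 1] nothing has to
    be gained, and for larger [d] the drop of the potential gains [1 / N], where [d <= N]. *)
Lemma step_term_bound f g c e : (\sum_e c e <= N)%N ->
  N%:R ^+ potential g f (incr c e) (g e) * moment_ratio (s e) (c e) <=
  N%:R ^+ potential f g c (f e) *
    (s e + (0 < open_deg g c (g e))%:R * s e * N%:R ^+ 2
     + (c e == 1%N)%:R / (open_deg f c (f e))%:R + (1 < c e)%:R * (N%:R * K)) :> R.
Proof.
move=> cN.
have N1 : 1 <= N%:R :> R by rewrite ler1n.
have N0 : 0 <= N%:R :> R by rewrite ler0n.
have mono a b : (a <= b)%N -> N%:R ^+ a <= N%:R ^+ b :> R by move=> ?; exact: ler_weXn2l.
case ce: (c e) => [|[|m]] /=; rewrite ?mul0r ?mul1r ?addr0 ?mulr1.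
- have := mono _ _ (@potential_new f g c e ce).
  rewrite exprD; case: (0 < _)%N => /=; rewrite ?mul0r ?mul1r ?addr0 ?expr0 ?mulr1 => H.
    apply: le_trans (ler_wpM2r (s_ge0 e) H) _.
    rewrite -mulrA ler_wpM2l ?exprn_ge0 // mulrC.
    by rewrite -[leLHS]add0r lerD2r s_ge0.
  exact: ler_wpM2r.
- have d0 : (0 < open_deg f c (f e))%N.
    by apply/card_gt0P; exists e; rewrite inE eqxx ce eqxx.
  set d := open_deg f c (f e) in d0 *.
  have dN : (d <= N)%N by apply: leq_trans cN; exact: open_deg_le.
  have := mono _ _ (@potential_open f g c e ce); rewrite -/d exprD => H.
  apply: (@le_trans _ _ (N%:R ^+ potential f g c (f e) / d%:R)); last first.
    rewrite ler_wpM2l ?exprn_ge0 // lerDr addr_ge0 ?s_ge0 //.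
    by rewrite !mulr_ge0 ?s_ge0 ?exprn_ge0.
  rewrite ler_pdivlMr ?ltr0n //; apply: le_trans H.
  rewrite ler_wpM2l ?exprn_ge0 //; case: ltnP => /=; first by rewrite expr1 ler_nat.
  by move=> d1; rewrite expr0 -[1]/(1%:R) ler_nat.
- have := mono _ _ (@potential_old f g c e _); rewrite ce => /(_ isT).
  rewrite exprSr => H; apply: le_trans (ler_wpM2r K_ge0 H) _.
  rewrite -(mulrA _ _ K) ler_wpM2l ?exprn_ge0 // lerDr addr_ge0 ?s_ge0 //.
  by rewrite !mulr_ge0 ?s_ge0 ?exprn_ge0.
Qed.

(** The four kinds of steps add up to [growth]: [n] targets of total variance [tau] each, at most
    [N] targets touched by an open edge, open edges sharing a total of 1, and at most [N] edges
    already used twice. *)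
Lemma step_bound f g c i : (\sum_e c e <= N)%N ->
  (forall i j, \sum_(e | (f e == i) && (g e == j)) s e <= tau) ->
  \sum_(e | f e == i) N%:R ^+ potential g f (incr c e) (g e) * walk_weight (incr c e) <=
  growth * (N%:R ^+ potential f g c i * walk_weight c).
Proof.
move=> cN Htau.
have N0 : 0 <= N%:R :> R by rewrite ler0n.
set d := open_deg f c i.
pose G := N%:R ^+ potential f g c i : R.
have G0 : 0 <= G by rewrite exprn_ge0.
pose t e : R := s e + (0 < open_deg g c (g e))%:R * s e * N%:R ^+ 2
     + (c e == 1%N)%:R / d%:R + (1 < c e)%:R * (N%:R * K).
apply: (@le_trans _ _ (\sum_(e | f e == i) (G * walk_weight c) * t e)).
  apply: ler_sum => e /eqP fe.
  rewrite walk_weight_incr mulrA (mulrAC G) ler_wpM2r ?walk_weight_ge0 //.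
  by have := @step_term_bound f g c e cN; rewrite fe.
rewrite -mulr_sumr mulrC ler_wpM2r ?mulr_ge0 ?walk_weight_ge0 //.
rewrite /growth !big_split /=; apply: lerD; first apply: lerD; first apply: lerD.
- rewrite (partition_big g xpredT) //=.
  apply: (@le_trans _ _ (\sum_(j < n) tau)); first exact: ler_sum.
  by rewrite sumr_const card_ord mulr_natl.
- rewrite -mulr_suml.
  suff key : \sum_(e | f e == i) (0 < open_deg g c (g e))%:R * s e <= N%:R * tau.
    apply: le_trans (ler_wpM2r _ key) _; first by rewrite exprn_ge0.
    rewrite [leLHS](_ : _ = N%:R ^+ 3 * tau) //; by ring.
  rewrite (partition_big g xpredT) //=.
  apply: (@le_trans _ _ (\sum_(j < n) (open_deg g c j)%:R * tau)).
    apply: ler_sum => j _.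
    apply: (@le_trans _ _ ((0 < open_deg g c j)%:R *
                           \sum_(e | (f e == i) && (g e == j)) s e)).
      by rewrite mulr_sumr; apply: ler_sum => e /andP[_ /eqP ->].
    case: (posnP (open_deg g c j)) => [->|d0] /=; first by rewrite !mul0r.
    by rewrite mul1r; apply: le_trans (Htau _ _) _; rewrite ler_peMl // ler1n.
  rewrite -mulr_suml ler_wpM2r // -natr_sum ler_nat.
  exact: leq_trans (sum_open_deg _ _) cN.
- rewrite -mulr_suml -natr_sum.
  have -> : (\sum_(e | f e == i) (c e == 1))%N = d.
    by rewrite /d /open_deg -sum1_card [in RHS]big_mkcondr; apply: eq_bigr => e _; case: eqP.
  case: (posnP d) => [->|d0]; first by rewrite mul0r.
  by rewrite divff // pnatr_eq0 -lt0n.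
- rewrite -mulr_suml exprS expr1 -mulrA ler_wpM2r ?mulr_ge0 // -natr_sum ler_nat.
  apply: leq_trans cN; rewrite big_mkcond; apply: leq_sum => e _.
  by case: (f e == i) => //; case: (c e) => [|[|]].
Qed.

Hypothesis Hmom : forall c, `|expect (monomial c)| <= walk_weight c.

(** The alternating product [M *m M^T *m M *m ...] with [r] factors; its entries are sums over walks
    of length [r] in the bipartite graph. *)
Fixpoint altp r (M : 'M[R]_n) : 'M[R]_n :=
  if r is r'.+1 then M *m altp r' M^T else 1%:M.

(** Induction on the remaining steps, for an arbitrary history [c]. Expanding the first factor picks
    an edge [e] at [i], absorbs [y e] into the monomial and continues from [g e] with the transposed
    matrix. *)
Lemma altp_moment r : forall f g c i k, (\sum_e c e + r <= N)%N ->
  (forall i j, \sum_(e | (f e == i) && (g e == j)) s e <= tau) ->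
  `|expect (fun a => monomial c a * altp r (edge_matrix f g a) i k)| <=
  growth ^+ r * (N%:R ^+ potential f g c i * walk_weight c).
Proof.
have N1 : 1 <= N%:R :> R by rewrite ler1n.
have gr0 : 0 <= growth by rewrite !addr_ge0 ?mulr_ge0 ?exprn_ge0.
elim: r => [|r IH] f g c i k cN Htau.
  rewrite expr0 mul1r; apply: (@le_trans _ _ (walk_weight c)); last first.
    by rewrite ler_peMl ?walk_weight_ge0 // exprn_ege1.
  apply: le_trans (Hmom c).
  have -> : expect (fun a => monomial c a * altp 0 (edge_matrix f g a) i k) =
            expect (monomial c) * (i == k)%:R.
    by rewrite /expect mulr_suml; apply: eq_bigr => a _; rewrite mxE mulrA.
  by rewrite normrM ler_piMr // normr_nat; case: (i == k).
have -> : expect (fun a => monomial c a * altp r.+1 (edge_matrix f g a) i k) =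
  \sum_(e | f e == i)
    expect (fun a => monomial (incr c e) a * altp r (edge_matrix g f a) (g e) k).
  rewrite /expect exchange_big /=; apply: eq_bigr => a _.
  rewrite edge_matrix_mul edge_matrix_tr !mulr_sumr; apply: eq_bigr => e _.
  by rewrite monomial_incr; ring.
apply: le_trans (ler_norm_sum _ _ _) _.
apply: (@le_trans _ _ (\sum_(e | f e == i) growth ^+ r *
   (N%:R ^+ potential g f (incr c e) (g e) * walk_weight (incr c e)))).
  apply: ler_sum => e _; apply: IH; first by rewrite sum_incr addSnnS.
  by move=> i' j'; under eq_bigl => e' do rewrite andbC; exact: Htau.
rewrite -mulr_sumr exprSr -mulrA ler_wpM2l ?exprn_ge0 //.
by apply: step_bound => //; apply: leq_trans cN; exact: leq_addr.
Qed.

(** The empty history has potential 0 and weight 1. *)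
Lemma altp_expect_le f g r i k : (r <= N)%N ->
  (forall i j, \sum_(e | (f e == i) && (g e == j)) s e <= tau) ->
  expect (fun a => altp r (edge_matrix f g a) i k) <= growth ^+ r.
Proof.
move=> rN Htau; apply: le_trans (ler_norm _) _.
have d0 f' v : open_deg f' (fun=> 0%N) v = 0%N.
  by apply: eq_card0 => e; rewrite inE andbF.
have := @altp_moment r f g (fun=> 0%N) i k; rewrite big1 // => /(_ rN Htau).
rewrite /potential d0 !big1 => [|v _|v _]; rewrite ?d0 //= expr0 mul1r.
rewrite /walk_weight big1 // mulr1; congr (`| _ | <= _).
by apply: eq_bigr => a _; rewrite /monomial big1 ?mul1r // => e _; rewrite expr0.
Qed.

End WalkMoments.

(** * Largest singular value and traces *)

Section MatrixNorms.
Variable R : realType.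

(** Lagrange's identity writes twice the defect as a sum of squares. *)
Lemma cauchy_schwarz (I : finType) (a b : I -> R) :
  (\sum_i a i * b i) ^+ 2 <= (\sum_i a i ^+ 2) * (\sum_i b i ^+ 2).
Proof.
rewrite -subr_ge0 -(pmulr_lge0 _ (ltr0n R 2)).
have -> : ((\sum_i a i ^+ 2) * (\sum_i b i ^+ 2) - (\sum_i a i * b i) ^+ 2) * 2%:R =
          \sum_i \sum_j (a i * b j - a j * b i) ^+ 2.
  transitivity (\sum_i \sum_j (a i ^+ 2 * b j ^+ 2 + (b i ^+ 2 * a j ^+ 2
                  - 2%:R * ((a i * b i) * (a j * b j))))); last first.
    by apply: eq_bigr => i _; apply: eq_bigr => j _; ring.
  have prodE (u v : I -> R) : \sum_i \sum_j u i * v j = (\sum_i u i) * (\sum_j v j).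
    by rewrite mulr_suml; apply: eq_bigr => i _; rewrite mulr_sumr.
  rewrite [RHS](eq_bigr (fun i => \sum_j a i ^+ 2 * b j ^+ 2 + (\sum_j b i ^+ 2 * a j ^+ 2
     - 2%:R * \sum_j (a i * b i) * (a j * b j)))); last first.
    by move=> i _; rewrite big_split sumrB mulr_sumr.
  rewrite big_split sumrB -mulr_sumr !prodE /=; ring.
by rewrite sumr_ge0 // => i _; rewrite sumr_ge0 // => j _; rewrite sqr_ge0.
Qed.

Lemma sum_normr_sqr_le (I : finType) (a : I -> R) :
  (\sum_i `|a i|) ^+ 2 <= #|I|%:R * \sum_i a i ^+ 2.
Proof.
have := cauchy_schwarz (fun=> 1) (fun i => `|a i|).
rewrite (eq_bigr (fun i => `|a i|)) => [|i _]; last by rewrite mul1r.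
by under [X in _ * X]eq_bigr => i _ do rewrite real_normK ?num_real //;
  rewrite expr1n sumr_const.
Qed.

(** Triangle inequality for the Euclidean norm, in squared form. *)
Lemma sum_sqrD_le (I : finType) (u v : I -> R) (a b : R) : 0 <= a -> 0 <= b ->
  \sum_i u i ^+ 2 <= a ^+ 2 -> \sum_i v i ^+ 2 <= b ^+ 2 ->
  \sum_i (u i + v i) ^+ 2 <= (a + b) ^+ 2.
Proof.
move=> a0 b0 ua vb.
have uv : \sum_i u i * v i <= a * b.
  apply: le_trans (ler_norm _) _.
  rewrite -(@ler_pXn2r _ 2) ?nnegrE ?mulr_ge0 // real_normK ?num_real //.
  apply: le_trans (cauchy_schwarz _ _) _; rewrite exprMn ler_pM //;
    by apply: sumr_ge0 => i _; rewrite sqr_ge0.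
have -> : \sum_i (u i + v i) ^+ 2 =
          \sum_i u i ^+ 2 + 2%:R * (\sum_i u i * v i) + \sum_i v i ^+ 2.
  by rewrite mulr_sumr -!big_split /=; apply: eq_bigr => i _; ring.
by lra.
Qed.

Definition sqnorm m (x : 'cV[R]_m) : R := \sum_i x i 0 ^+ 2.

Definition frob m p (M : 'M[R]_(m, p)) : R := \sum_i \sum_j M i j ^+ 2.

Lemma sqnorm_ge0 m (x : 'cV[R]_m) : 0 <= sqnorm x.
Proof. by apply: sumr_ge0 => i _; rewrite sqr_ge0. Qed.

Lemma sqnormE m (x : 'cV[R]_m) : sqnorm x = (x^T *m x) 0 0.
Proof. by rewrite mxE; apply: eq_bigr => i _; rewrite mxE expr2. Qed.

Lemma sqnorm_mulmx_le m p (M : 'M[R]_(m, p)) (x : 'cV[R]_p) :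
  sqnorm (M *m x) <= frob M * sqnorm x.
Proof.
rewrite /frob mulr_suml; apply: ler_sum => i _; rewrite mxE.
exact: (cauchy_schwarz (fun j => M i j) (fun j => x j 0)).
Qed.

Lemma quadratic_sqr_le m (S : 'M[R]_m) (x : 'cV[R]_m) : S^T = S -> sqnorm x = 1 ->
  ((x^T *m S *m x) 0 0) ^+ 2 <= (x^T *m (S *m S) *m x) 0 0.
Proof.
move=> St x1.
have -> : (x^T *m (S *m S) *m x) 0 0 = sqnorm (S *m x).
  by rewrite sqnormE trmx_mul St !mulmxA.
rewrite -mulmxA mxE; apply: le_trans (cauchy_schwarz _ _) _.
rewrite [X in X * _](_ : _ = 1) ?mul1r // -x1.
by apply: eq_bigr => i _; rewrite mxE.
Qed.

Lemma altp_double m r (M : 'M[R]_m) : altp r.+2 M = M *m M^T *m altp r M.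
Proof. by rewrite /= trmxK mulmxA. Qed.

Lemma altp_add m q r (M : 'M[R]_m) : altp (q.*2 + r) M = altp q.*2 M *m altp r M.
Proof.
elim: q => [|q IH]; first by rewrite mul1mx.
by rewrite doubleS !addSn !altp_double IH mulmxA.
Qed.

Lemma altp_sym m q (M : 'M[R]_m) : (altp q.*2 M)^T = altp q.*2 M.
Proof.
elim: q => [|q IH]; first by rewrite trmx1.
have step : altp q.+1.*2 M = altp q.*2 M *m (M *m M^T).
  by rewrite -addn1 doubleD altp_add /= mulmx1.
by rewrite {1}step !trmx_mul IH trmxK doubleS altp_double.
Qed.

(** Starting from the quadratic form of [M^T *m M] at [x], each use of [quadratic_sqr_le] doubles
    the power. The last doubling uses [sqnorm (T *m x) <= frob T], which for symmetric [T] is the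
    trace of [T *m T]. *)
Lemma sqnorm_pow_le_trace m k (M : 'M[R]_m) (x : 'cV[R]_m) : sqnorm x = 1 ->
  sqnorm (M *m x) ^+ (2 ^ k.+1) <= \tr (altp (2 ^ k.+2) M^T).
Proof.
move=> x1.
have dbl k' : altp (2 ^ k'.+1.+1) M^T = altp (2 ^ k'.+1) M^T *m altp (2 ^ k'.+1) M^T.
  have -> : (2 ^ k'.+2 = (2 ^ k').*2 + 2 ^ k'.+1)%N by rewrite !expnS; lia.
  by rewrite altp_add -mul2n -expnS.
have sym k' : (altp (2 ^ k'.+1) M^T)^T = altp (2 ^ k'.+1) M^T.
  by rewrite expnS mul2n altp_sym.
have quad k' : sqnorm (M *m x) ^+ (2 ^ k') <= (x^T *m altp (2 ^ k'.+1) M^T *m x) 0 0.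
  elim: k' => [|k' IH]; first by rewrite sqnormE /= trmx_mul trmxK mulmx1 !mulmxA.
  rewrite dbl; apply: le_trans (quadratic_sqr_le (sym _) x1).
  have p0 : 0 <= sqnorm (M *m x) ^+ (2 ^ k') by rewrite exprn_ge0 ?sqnorm_ge0.
  by rewrite [X in _ ^+ X <= _]expnSr exprM lerXn2r ?nnegrE ?(le_trans p0).
apply: le_trans (quad _) _; rewrite dbl.
set T := altp _ _; have Tt : T^T = T by exact: sym.
have -> : (x^T *m (T *m T) *m x) 0 0 = sqnorm (T *m x).
  by rewrite sqnormE trmx_mul Tt !mulmxA.
apply: le_trans (sqnorm_mulmx_le _ _) _; rewrite x1 mulr1 /mxtrace le_eqVlt.
apply/orP; left; apply/eqP; apply: eq_bigr => i _; rewrite mxE.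
by apply: eq_bigr => j _; rewrite -{3}Tt mxE expr2.
Qed.

Lemma exists_unit_vector p : (0 < p)%N -> exists x : 'cV[R]_p, sqnorm x = 1.
Proof.
case: p => // p _; exists (delta_mx 0 0).
rewrite /sqnorm (bigD1 0) //= mxE big1 ?expr1n ?addr0 // => j j0.
by rewrite mxE (negbTE j0) expr0n.
Qed.

Lemma sigma1_le m p (M : 'M[R]_(m, p)) (b : R) : (0 < p)%N -> 0 <= b ->
  (forall x : 'cV[R]_p, sqnorm x = 1 -> sqnorm (M *m x) <= b ^+ 2) -> sigma1 M <= b.
Proof.
move=> p0 b0 H; apply: ge_sup.
  have [x x1] := exists_unit_vector p0.
  by exists (Num.sqrt (sqnorm (M *m x))), x.
move=> _ [x [x1 ->]]; rewrite -(ger0_norm b0) -sqrtr_sqr; apply: ler_wsqrtr.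
exact: H.
Qed.

End MatrixNorms.

(** * Independent Bernoulli entries *)

Section BernoulliProduct.
Variables (R : realType) (n L : nat).
Local Notation edge := ('I_L * ('I_n * 'I_n))%type.
Variable q : edge -> R.
Hypothesis q01 : forall e, 0 <= q e <= 1.

Definition entry (A : config n L) (e : edge) : bool := A e.1 e.2.1 e.2.2.

Definition bern_weight (A : config n L) : R := \prod_e bern (q e) (entry A e).

Definition centered (A : config n L) (e : edge) : R := (entry A e)%:R - q e.

(** Independence: distributivity turns the product of two-point sums into a sum over boolean
    functions on edges, which are in bijection with configurations. *)
Lemma expect_prod (h : edge -> bool -> R) :
  expect bern_weight (fun A => \prod_e h e (entry A e)) =
  \prod_e (bern (q e) true * h e true + bern (q e) false * h e false).
Proof.
transitivity (\prod_e \sum_(b : bool) bern (q e) b * h e b); last first.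
  by apply: eq_bigr => e _; rewrite big_bool.
rewrite bigA_distr_bigA /=.
pose to_config (w : {ffun edge -> bool}) : config n L :=
  [ffun l => \matrix_(i, j) w (l, (i, j))].
have entryK w e : entry (to_config w) e = w e.
  by case: e => l [i j]; rewrite /entry ffunE mxE.
rewrite /expect (reindex to_config) /=.
  by apply: eq_bigr => w _; rewrite -big_split; apply: eq_bigr => e _; rewrite entryK.
exists (fun A => [ffun e => entry A e]) => [w _|A _].
  by apply/ffunP => e; rewrite ffunE entryK.
by apply/ffunP => l; apply/matrixP => i j; rewrite ffunE mxE ffunE.
Qed.

Lemma bern_ge0 e b : 0 <= bern (q e) b.
Proof. by case/andP: (q01 e); case: b => /= *; rewrite ?subr_ge0. Qed.

Lemma bern_weight_ge0 A : 0 <= bern_weight A.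
Proof. by apply: prodr_ge0 => e _; exact: bern_ge0. Qed.

Lemma expect_cst c : expect bern_weight (fun=> c) = c.
Proof.
have := expect_prod (fun _ _ => 1).
rewrite [RHS]big1 => [H|e _]; last by rewrite /= !mulr1 addrC subrK.
rewrite /expect -mulr_suml -[RHS]mul1r -H; congr (_ * _).
by apply: eq_bigr => A _; rewrite big1_eq mulr1.
Qed.

Lemma expect_le h1 h2 : (forall A, h1 A <= h2 A) ->
  expect bern_weight h1 <= expect bern_weight h2.
Proof. by move=> h12; apply: ler_sum => A _; rewrite ler_wpM2l ?bern_weight_ge0. Qed.

Lemma expectD h1 h2 : expect bern_weight (fun A => h1 A + h2 A) =
  expect bern_weight h1 + expect bern_weight h2.
Proof. by rewrite /expect -big_split; apply: eq_bigr => A _; rewrite mulrDr. Qed.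

Lemma expectZ c h : expect bern_weight (fun A => c * h A) = c * expect bern_weight h.
Proof. by rewrite /expect mulr_sumr; apply: eq_bigr => A _; rewrite mulrCA. Qed.

Lemma expect_sum (I : finType) (D : pred I) h :
  expect bern_weight (fun A => \sum_(i | D i) h i A) =
  \sum_(i | D i) expect bern_weight (h i).
Proof. by rewrite /expect exchange_big; apply: eq_bigr => A _; rewrite mulr_sumr. Qed.

Section Scaled.
Variables (t : edge -> R) (K : R).
Hypothesis tK : forall e, 0 <= t e <= K.

Definition scaled_entry e (A : config n L) : R := centered A e * t e.
Definition scaled_var e : R := q e * (1 - q e) * t e ^+ 2.

Lemma scaled_var_ge0 e : 0 <= scaled_var e.
Proof.
case/andP: (q01 e) => q0 q1; apply: mulr_ge0; last exact: sqr_ge0.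
by rewrite mulr_ge0 ?subr_ge0.
Qed.

(** For [m >= 2] two factors produce the variance and each other factor is at most [K] in absolute
    value; for [m = 1] the mean vanishes. *)
Lemma bernoulli_moment e m :
  `|bern (q e) true * ((1 - q e) * t e) ^+ m +
    bern (q e) false * ((0 - q e) * t e) ^+ m| <= moment_bound K (scaled_var e) m.
Proof.
case/andP: (q01 e) (tK e) => q0 q1 /andP[t0 tKe].
case: m => [|[|m]]; rewrite /= /scaled_var.
- by rewrite !expr0 !mulr1 addrC subrK normr1.
- rewrite !expr1 [X in `|X|](_ : _ = 0); last by ring.
  by rewrite normr0; exact: scaled_var_ge0.
have K0 : 0 <= K by exact: le_trans tKe.
have bnd z : `|z| <= 1 -> `|(z * t e) ^+ m| <= K ^+ m.
  move=> z1; rewrite normrX lerXn2r ?nnegrE // normrM (ger0_norm t0).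
  by rewrite -[leRHS]mul1r ler_pM.
have b1 := bnd (1 - q e); have b0 := bnd (0 - q e).
have {}b1 : `|((1 - q e) * t e) ^+ m| <= K ^+ m by apply: b1; rewrite ler_norml; lra.
have {}b0 : `|((0 - q e) * t e) ^+ m| <= K ^+ m by apply: b0; rewrite ler_norml; lra.
rewrite -addn2 !exprD.
have normE (w z z' : R) : 0 <= w -> `|w * (z * z' ^+ 2)| = w * (`|z| * z' ^+ 2).
  by move=> w0; rewrite normrM (ger0_norm w0) normrM (ger0_norm (sqr_ge0 z')).
apply: le_trans (ler_normD _ _) _; rewrite !normE ?subr_ge0 //.
have sq z : 0 <= (z * t e) ^+ 2 by exact: sqr_ge0.
apply: (@le_trans _ _ (q e * (K ^+ m * ((1 - q e) * t e) ^+ 2) +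
                       (1 - q e) * (K ^+ m * ((0 - q e) * t e) ^+ 2))).
  by rewrite lerD // ler_wpM2l ?subr_ge0 // ler_wpM2r.
by rewrite [leLHS](_ : _ = q e * (1 - q e) * t e ^+ 2 * K ^+ m) //; ring.
Qed.

Lemma scaled_monomial_moment c :
  `|expect bern_weight (monomial scaled_entry c)| <= walk_weight scaled_var K c.
Proof.
rewrite (expect_prod (fun e b => ((b%:R - q e) * t e) ^+ c e)) normr_prod.
by apply: ler_prod => e _; rewrite normr_ge0; exact: bernoulli_moment.
Qed.

End Scaled.

Lemma centered_orthogonal e e' : e != e' ->
  expect bern_weight (fun A => centered A e * centered A e') = 0.
Proof.
(* Padding with 1 at all other edges gives the product form of [expect_prod]; the factor at [e] is
   then a centered mean. *)
move=> ne; pose h e0 (b : bool) : R :=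
  (if e0 == e then b%:R - q e else 1) * (if e0 == e' then b%:R - q e' else 1).
transitivity (expect bern_weight (fun A => \prod_e0 h e0 (entry A e0))).
  apply: eq_bigr => A _; congr (_ * _).
  by rewrite /h big_split -!big_mkcond /= !big_pred1_eq.
rewrite expect_prod (bigD1 e) //= /h eqxx (negbTE ne) /=.
by rewrite [X in X * _](_ : _ = 0) ?mul0r //; ring.
Qed.

Lemma centered_sqr_le e : expect bern_weight (fun A => centered A e ^+ 2) <= 1.
Proof.
rewrite -[leRHS]expect_cst; apply: expect_le => A; rewrite /centered.
case/andP: (q01 e) => *; rewrite -real_normK ?num_real // expr_le1 // ler_norml.
by case: (entry A e) => /=; lra.
Qed.

Lemma centered_sum_sqr_le (D : pred edge) :
  expect bern_weight (fun A => (\sum_(e | D e) centered A e) ^+ 2) <= #|D|%:R.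
Proof.
have -> : expect bern_weight (fun A => (\sum_(e | D e) centered A e) ^+ 2) =
  \sum_(e | D e) \sum_(e' | D e') expect bern_weight (fun A => centered A e * centered A e').
  under eq_bigr => e _ do rewrite -expect_sum.
  rewrite -expect_sum; apply: eq_bigr => A _; congr (_ * _).
  by rewrite expr2 mulr_suml; apply: eq_bigr => e _; rewrite mulr_sumr.
apply: (@le_trans _ _ (\sum_(e | D e) 1)); last by rewrite sumr_const.
apply: ler_sum => e De; rewrite (bigD1 e) //= big1 ?addr0; last first.
  by move=> e' /andP[_ ne]; rewrite centered_orthogonal // eq_sym.
exact: (centered_sqr_le e).
Qed.

End BernoulliProduct.

(** A forced zero on the diagonal is a Bernoulli variable of mean 0, so all entries fit one product
    weight. *)
Lemma mlscbm_weightE (R : realType) n L ks kr (B : 'I_L -> 'M[R]_(ks, kr))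
    (gs : 'I_n -> 'I_ks) (gr : 'I_n -> 'I_kr) (A : config n L) :
  mlscbm_weight B gs gr A =
  bern_weight (fun e => Omega B gs gr e.1 e.2.1 e.2.2) A.
Proof.
rewrite /bern_weight -(pair_bigA _ (fun l ij => bern (Omega B gs gr l ij.1 ij.2)
  (A l ij.1 ij.2))) /=; apply: eq_bigr => l _.
rewrite -(pair_bigA _ (fun i j => bern (Omega B gs gr l i j) (A l i j))) /=.
apply: eq_bigr => i _; apply: eq_bigr => j _; rewrite /Omega.
by case: (i == j) => //; case: (A l i j); rewrite /= ?subr0.
Qed.

(** Compares one entry of the empirical and ideal residuals when numerator and variance sum each
    move by at most [d]. Here [l] stands for the number of layers and [kappa] bounds the variance
    per layer from below; the last hypothesis keeps [v'] above half the bound for [v]. *)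
Lemma studentized_diff_le (R : realType) (l kappa m a a' v v' d : R) :
  0 < l -> 0 < kappa -> 0 < m -> `|a'| <= l -> `|a' - a| <= d -> `|v' - v| <= d ->
  l * kappa <= v -> d <= l * kappa / 2 ->
  (a' / Num.sqrt (m * v') - a / Num.sqrt (m * v)) ^+ 2 <=
  2 * (kappa^-1 + 1) ^+ 2 / kappa * (d ^+ 2 / (l * m)).
Proof.
move=> l0 k0 m0 ha' had hvd hv hd.
have lk0 : 0 < l * kappa by rewrite mulr_gt0.
have hv' : l * kappa / 2 <= v' by move: hvd; rewrite ler_norml; lra.
have d0 : 0 <= d by exact: le_trans (normr_ge0 _) had.
have v0 : 0 < v by lra.
have v'0 : 0 < v' by lra.
rewrite !sqrtrM ?(ltW m0) //.
set mu := Num.sqrt m; set s := Num.sqrt v; set s' := Num.sqrt v'.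
set b := Num.sqrt (l * kappa / 2).
have mu0 : 0 < mu by rewrite sqrtr_gt0.
have s0 : 0 < s by rewrite sqrtr_gt0.
have s'0 : 0 < s' by rewrite sqrtr_gt0.
have b0 : 0 < b by rewrite sqrtr_gt0; lra.
have bs : b <= s by rewrite ler_wsqrtr //; lra.
have bs' : b <= s' by rewrite ler_wsqrtr.
have s2 : s ^+ 2 = v by rewrite sqr_sqrtr // ltW.
have s'2 : s' ^+ 2 = v' by rewrite sqr_sqrtr // ltW.
have b2 : b ^+ 2 = l * kappa / 2 by rewrite sqr_sqrtr //; lra.
have mu2 : mu ^+ 2 = m by rewrite sqr_sqrtr // ltW.
(* Factor [s ^+ 2 - s' ^+ 2] and use [s <= s + s']. *)
have ss : `|s - s'| <= d / s.
  rewrite ler_pdivlMr //; apply: le_trans hvd.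
  rewrite -s2 -s'2 distrC subr_sqr normrM distrC ler_wpM2l //.
  by rewrite ger0_norm; lra.
(* Separates the change of the denominator from that of the numerator. *)
have -> : a' / (mu * s') - a / (mu * s) =
          (a' * (s - s') / (s * s') + (a' - a) / s) / mu.
  by field; rewrite !gt_eqF.
have key : `|(a' * (s - s') / (s * s') + (a' - a) / s) / mu| <=
           d * (kappa^-1 + 1) / (b * mu).
  rewrite normrM normfV (gtr0_norm mu0) [leRHS](_ : _ = d * (kappa^-1 + 1) / b / mu); last first.
    by field; rewrite !gt_eqF.
  rewrite ler_pM2r ?invr_gt0 //.
  rewrite [leRHS](_ : _ = d * (kappa^-1 / b) + d / b); last by ring.
  apply: le_trans (ler_normD _ _) _; apply: lerD.
    rewrite normrM normfV (gtr0_norm (mulr_gt0 s0 s'0)) normrM.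
    apply: (@le_trans _ _ (l * (d / s) / (s * s'))).
      by rewrite ler_pM2r ?invr_gt0 ?mulr_gt0 // ler_pM.
    rewrite [leLHS](_ : _ = d * (l / v / s')); last first.
      by rewrite -s2; field; rewrite !gt_eqF.
    have lv : l / v <= kappa^-1 by rewrite ler_pdivrMr // ler_pdivlMl // mulrC.
    rewrite ler_wpM2l // ler_pM // ?divr_ge0 ?invr_ge0 ?(ltW l0) ?(ltW v0) ?(ltW s'0) //.
    by rewrite lef_pV2 ?posrE.
  rewrite normrM normfV (gtr0_norm s0) ler_pM ?invr_ge0 ?(ltW s0) //.
  by rewrite lef_pV2 ?posrE.
set z := _ / mu in key *; rewrite -(real_normK (num_real z)).
apply: (@le_trans _ _ ((d * (kappa^-1 + 1) / (b * mu)) ^+ 2)).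
  by rewrite lerXn2r ?nnegrE // (le_trans _ key).
rewrite !exprMn exprVn exprMn b2 mu2 le_eqVlt; apply/orP; left; apply/eqP.
by field; rewrite !gt_eqF.
Qed.

(* In the scope of Defs, [[set x | p x]] is a classical set. *)
Lemma mem_setb (T : Type) (p : pred T) x : (x \in [set x | p x]) = p x.
Proof. by apply/idP/idP; rewrite inE. Qed.

(** * The residual matrix for a fixed number of nodes *)

Lemma eq_up_to_perm_inj n a b (h : 'I_n -> 'I_a) (g : 'I_n -> 'I_b) :
  eq_up_to_perm h g -> forall i j, (h i == h j) = (g i == g j).
Proof. by case=> f [/bij_inj f_inj hE] i j; rewrite !hE (inj_eq f_inj). Qed.

(** The residual matrix depends on the labels only through the partitions they induce. Where the
    labels are recovered, it can thus be computed from the true ones. *)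
Lemma Rhat_perm (R : realType) n L a b a' b' (A : config n L)
    (hs : 'I_n -> 'I_a) (hr : 'I_n -> 'I_b) (gs : 'I_n -> 'I_a') (gr : 'I_n -> 'I_b') :
  eq_up_to_perm hs gs -> eq_up_to_perm hr gr -> Rhat R A hs hr = Rhat R A gs gr.
Proof.
move=> /eq_up_to_perm_inj Hs /eq_up_to_perm_inj Hr.
have OmE l i j : Omegahat R A hs hr l i j = Omegahat R A gs gr l i j.
  rewrite /Omegahat; case: eqP => // _; rewrite !mxE.
  congr (_ / (_ * _)%:R).
  - rewrite (eq_bigl (fun i' => gs i' == gs i)) //; apply: eq_bigr => i' _.
    exact: eq_bigl.
  - by apply: eq_card => i'; rewrite !mem_setb.
  - by apply: eq_card => i'; rewrite !mem_setb.
apply/matrixP => i j; rewrite !mxE; case: eqP => // _.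
by congr (_ / Num.sqrt (_ * _)); apply: eq_bigr => l _; rewrite OmE.
Qed.

Section Model.
Variables (R : realType) (n L ks kr : nat) (B : 'I_L -> 'M[R]_(ks, kr)).
Variables (gs : 'I_n -> 'I_ks) (gr : 'I_n -> 'I_kr) (delta c0 : R).
Hypothesis n_gt1 : (1 < n)%N.
Hypothesis L_gt0 : (0 < L)%N.
Hypothesis delta01 : 0 < delta < 1 / 2.
Hypothesis B_bnd : forall l k k', delta <= B l k k' <= 1 - delta.
Hypothesis c0_gt0 : 0 < c0.
Hypothesis size_s : forall k, c0 * n%:R / ks%:R <= #|[set i | gs i == k]|%:R.
Hypothesis size_r : forall k, c0 * n%:R / kr%:R <= #|[set j | gr j == k]|%:R.

Local Notation edge := ('I_L * ('I_n * 'I_n))%type.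

Definition edge_mean (e : edge) : R := Omega B gs gr e.1 e.2.1 e.2.2.

Definition edge_var (i j : 'I_n) : R :=
  \sum_l Omega B gs gr l i j * (1 - Omega B gs gr l i j).

(* On the diagonal [edge_var] vanishes and [x / 0 = 0] makes the scale 0. *)
Definition edge_scale (e : edge) : R :=
  (Num.sqrt (n.-1%:R * edge_var e.2.1 e.2.2))^-1.

(** Comes from the variance bound [L * delta ^+ 2] with [L >= 1]. *)
Definition max_scale : R := (Num.sqrt (n.-1%:R * delta ^+ 2))^-1.

Definition ideal_residual (A : config n L) : 'M[R]_n :=
  edge_matrix (scaled_entry edge_mean edge_scale) (fun e => e.2.1) (fun e => e.2.2) A.

Definition block_err (k : 'I_ks) (k' : 'I_kr) (A : config n L) : R :=
  \sum_l (Bhat R A gs gr l k k' - B l k k') ^+ 2.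

Local Notation Ex := (expect (bern_weight edge_mean)).
Local Notation kmax := ((maxn ks kr)%:R : R).

Lemma edge_mean01 e : 0 <= edge_mean e <= 1.
Proof.
rewrite /edge_mean /Omega; case: eqP => _; first by rewrite lexx ler01.
have /andP[b0 b1] := B_bnd e.1 (gs e.2.1) (gr e.2.2).
by have /andP[d0 _] := delta01; apply/andP; split; lra.
Qed.

Lemma sum_parallel (F : edge -> R) i j :
  \sum_(e | (e.2.1 == i) && (e.2.2 == j)) F e = \sum_l F (l, (i, j)).
Proof.
rewrite (reindex_onto (fun l => (l, (i, j))) fst) /=.
  by apply: eq_bigl => l; rewrite !eqxx.
by move=> [l [i' j']] /= /andP[/eqP -> /eqP ->].
Qed.

Lemma sum_block (F : edge -> R) (l : 'I_L) (k : 'I_ks) (k' : 'I_kr) :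
  \sum_(e : edge | [&& e.1 == l, gs e.2.1 == k & gr e.2.2 == k']) F e =
  \sum_(i | gs i == k) \sum_(j | gr j == k') F (l, (i, j)).
Proof.
rewrite pair_big /= (reindex_onto (fun p => (l, p)) snd) /=.
  by apply: eq_big => [[i j]|[i j] _]; rewrite /= ?eqxx ?andbT.
by move=> [l' p] /= /andP[/eqP ->].
Qed.

Lemma edge_var_diag i : edge_var i i = 0.
Proof. by apply: big1 => l _; rewrite /Omega eqxx mul0r. Qed.

Lemma edge_var_ge i j : i != j -> L%:R * delta ^+ 2 <= edge_var i j.
Proof.
move=> /negbTE ne; rewrite mulr_natl -{1}(card_ord L) -sumr_const; apply: ler_sum => l _.
rewrite /Omega ne; have /andP[b0 b1] := B_bnd l (gs i) (gr j); rewrite expr2.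
by case/andP: delta01 => d0 _; apply: ler_pM; lra.
Qed.

Let pn_gt0 : 0 < n.-1%:R :> R.
Proof. by rewrite ltr0n; case: (n) n_gt1 => [|[]]. Qed.

Let Lr_ge1 : 1 <= L%:R :> R.
Proof. by rewrite ler1n. Qed.

Let delta_gt0 : 0 < delta.
Proof. by case/andP: delta01. Qed.

Lemma edge_var_gt0 i j : i != j -> 0 < edge_var i j.
Proof.
move=> ne; apply: lt_le_trans (edge_var_ge ne).
by rewrite mulr_gt0 ?exprn_gt0 // (lt_le_trans ltr01).
Qed.

Lemma edge_scale_bnd e : 0 <= edge_scale e <= max_scale.
Proof.
rewrite invr_ge0 sqrtr_ge0 /= /edge_scale /max_scale.
have [->|ne] := eqVneq e.2.1 e.2.2.
  by rewrite edge_var_diag mulr0 sqrtr0 invr0 invr_ge0 sqrtr_ge0.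
have d2 : 0 < delta ^+ 2 by rewrite exprn_gt0.
rewrite lef_pV2 ?posrE ?sqrtr_gt0 ?mulr_gt0 ?edge_var_gt0 // ler_wsqrtr //.
rewrite ler_pM2l //; apply: le_trans (edge_var_ge ne).
by rewrite -[leLHS]mul1r ler_wpM2r // ltW.
Qed.

(** The layer variances add up to [edge_var], which the squared scale cancels. *)
Lemma scaled_var_sum i j :
  \sum_(e | (e.2.1 == i) && (e.2.2 == j)) scaled_var edge_mean edge_scale e <= n.-1%:R^-1.
Proof.
rewrite sum_parallel /scaled_var /edge_mean /edge_scale /= -mulr_suml -/(edge_var i j).
have [->|ne] := eqVneq i j; first by rewrite edge_var_diag mul0r invr_ge0 ltW.
have v0 := edge_var_gt0 ne.
rewrite exprVn sqr_sqrtr ?mulr_ge0 ?(ltW v0) //.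
by rewrite [leLHS](_ : _ = n.-1%:R^-1) //; field; rewrite !gt_eqF.
Qed.

(** The walk bound with [K = max_scale] and [tau = 1 / (n - 1)], once per diagonal entry. *)
Lemma trace_moment N : (0 < N)%N ->
  Ex (fun A => \tr (altp N (ideal_residual A)^T)) <=
  n%:R * growth n max_scale n.-1%:R^-1 N ^+ N.
Proof.
move=> N0; have sum_cst x : \sum_(i < n) x = n%:R * x :> R by rewrite sumr_const card_ord mulr_natl.
rewrite expect_sum -sum_cst.
apply: ler_sum => i _; rewrite /ideal_residual.
under eq_fun => A do rewrite edge_matrix_tr.
apply: (altp_expect_le (s := scaled_var edge_mean edge_scale)) => //.
- by rewrite /max_scale invr_ge0 sqrtr_ge0.
- by move=> e; apply: scaled_var_ge0; exact: edge_mean01.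
- by apply: scaled_monomial_moment; [exact: edge_mean01 | exact: edge_scale_bnd].
- move=> i' j'; rewrite (eq_bigl (fun e => (e.2.1 == j') && (e.2.2 == i'))).
    exact: scaled_var_sum.
  by move=> e; rewrite andbC.
Qed.

(** * Mean squared error of the block averages *)

Section Block.
Variables (k : 'I_ks) (k' : 'I_kr).
Let ns := #|[set i | gs i == k]|.
Let nr := #|[set j | gr j == k']|.
(** Diagonal positions inside the block: their mean is 0 instead of [B l k k'], which biases the
    block average. *)
Let overlap := #|[set i | (gs i == k) && (gr i == k')]|.

Let sum_mean l : \sum_(i | gs i == k) \sum_(j | gr j == k') Omega B gs gr l i j =
  B l k k' * (ns%:R * nr%:R - overlap%:R).
Proof.
transitivity (\sum_(i | gs i == k) B l k k' * (nr%:R - (gr i == k')%:R)).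
  apply: eq_bigr => i /eqP gi.
  transitivity (\sum_(j | gr j == k') (B l k k' - B l k k' * (i == j)%:R)).
    apply: eq_bigr => j /eqP gj; rewrite /Omega gi gj.
    by case: eqP => _; rewrite ?mulr1 ?subrr ?mulr0 ?subr0.
  rewrite sumrB sumr_const mulrBr -mulr_sumr; congr (_ - _ * _).
    by rewrite mulr_natr; congr (_ *+ _); apply: eq_card => j; rewrite mem_setb.
  rewrite big_mkcond (bigD1 i) //= eqxx big1 ?addr0; first by case: ifP.
  by move=> j ne; rewrite (eq_sym i j) (negbTE ne); case: ifP.
rewrite -mulr_sumr sumrB sumr_const; congr (_ * (_ - _)).
  by rewrite mulr_natl; congr (_ *+ _); apply: eq_card => j; rewrite mem_setb.
rewrite -natr_sum; congr (_%:R); rewrite /overlap -sum1_card.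
rewrite [RHS](eq_bigl (fun i => (gs i == k) && (gr i == k'))).
  by rewrite [RHS]big_mkcondr; apply: eq_bigr => i _; case: eqP.
by move=> i; rewrite mem_setb.
Qed.

Let n_gt0 : (0 < n)%N.
Proof. exact: ltnW. Qed.

Let ns_gt0 : 0 < ns%:R :> R.
Proof.
apply: lt_le_trans (size_s k); rewrite divr_gt0 ?mulr_gt0 ?ltr0n //.
exact: leq_trans (ltn_ord k).
Qed.

Let nr_gt0 : 0 < nr%:R :> R.
Proof.
apply: lt_le_trans (size_r k'); rewrite divr_gt0 ?mulr_gt0 ?ltr0n //.
exact: leq_trans (ltn_ord k').
Qed.

Lemma Bhat_err l A : Bhat R A gs gr l k k' - B l k k' =
  (\sum_(e : edge | [&& e.1 == l, gs e.2.1 == k & gr e.2.2 == k']) centered edge_mean A e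
    - B l k k' * overlap%:R) / (ns%:R * nr%:R).
Proof.
rewrite sum_block.
have -> : \sum_(i | gs i == k) \sum_(j | gr j == k') centered edge_mean A (l, (i, j)) =
  (\sum_(i | gs i == k) \sum_(j | gr j == k') (A l i j)%:R)
   - B l k k' * (ns%:R * nr%:R - overlap%:R).
  rewrite -sum_mean -sumrB; apply: eq_bigr => i _; rewrite -sumrB.
  by apply: eq_bigr.
rewrite mxE natrM -/ns -/nr; field.
by rewrite (gt_eqF ns_gt0) (gt_eqF nr_gt0).
Qed.

(** Variance and squared bias of the block sum are each at most [ns * nr], the latter because
    [overlap] is at most [ns] and at most [nr]. The community sizes then bound [ns * nr] below by
    [(c0 * n / kmax) ^ 2]. *)
Lemma Bhat_mse l : Ex (fun A => (Bhat R A gs gr l k k' - B l k k') ^+ 2) <=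
  4 * kmax ^+ 2 / (c0 * n%:R) ^+ 2.
Proof.
have s0 := ns_gt0; have r0 := nr_gt0.
pose D (e : edge) := [&& e.1 == l, gs e.2.1 == k & gr e.2.2 == k'].
have cD : #|D|%:R = ns%:R * nr%:R :> R.
  rewrite -sum1_card natr_sum (sum_block (fun=> 1%:R)).
  transitivity (\sum_(i | gs i == k) nr%:R : R).
    apply: eq_bigr => i _; rewrite sumr_const; congr (_ *+ _).
    by apply: eq_card => j; rewrite mem_setb.
  by rewrite sumr_const mulr_natl; congr (_ *+ _); apply: eq_card => j; rewrite mem_setb.
have ov : overlap%:R ^+ 2 <= ns%:R * nr%:R :> R.
  rewrite -natrX -natrM ler_nat expnS expn1 leq_mul // subset_leq_card //;
  by apply/fintype.subsetP => i; rewrite !mem_setb => /andP[].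
apply: (@le_trans _ _ (4 / (ns%:R * nr%:R))).
  pose c := 2 / (ns%:R * nr%:R) ^+ 2 : R.
  apply: (@le_trans _ _ (Ex (fun A => c * (\sum_(e | D e) centered edge_mean A e) ^+ 2
                                  + c * (ns%:R * nr%:R)))).
    apply: expect_le => [|A]; first exact: edge_mean01.
    rewrite Bhat_err -/D expr_div_n; set z := \sum_(e | _) _.
    rewrite [leRHS](_ : _ = 2 * (z ^+ 2 + ns%:R * nr%:R) / (ns%:R * nr%:R) ^+ 2); last first.
      by rewrite /c; ring.
    rewrite ler_wpM2r ?invr_ge0 ?sqr_ge0 //.
    have b2 : (B l k k' * overlap%:R) ^+ 2 <= ns%:R * nr%:R.
      apply: le_trans ov; rewrite exprMn ler_piMl ?sqr_ge0 // expr_le1 //;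
      by have /andP[b0 b1] := B_bnd l k k'; have /andP[d0 _] := delta01; lra.
    have := sqr_ge0 (z + B l k k' * overlap%:R); lra.
  rewrite expectD expectZ expect_cst -mulrDr.
  have := centered_sum_sqr_le edge_mean01 D; rewrite cD => H.
  apply: (@le_trans _ _ (c * (ns%:R * nr%:R + ns%:R * nr%:R))).
    rewrite ler_wpM2l ?lerD2r // divr_ge0 ?exprn_ge0 ?mulr_ge0 //.
  by rewrite [leLHS](_ : _ = 4 / (ns%:R * nr%:R)) // /c; field; rewrite !gt_eqF.
have ks0 : 0 < ks%:R :> R by rewrite ltr0n (leq_trans _ (ltn_ord k)).
have kr0 : 0 < kr%:R :> R by rewrite ltr0n (leq_trans _ (ltn_ord k')).
have cn0 : 0 < c0 * n%:R by rewrite mulr_gt0 ?ltr0n.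
have hs := size_s k; have hr := size_r k'.
rewrite ler_pdivlMr ?exprn_gt0 // -mulrA ler_wpM2l // ler_pdivrMl ?mulr_gt0 //.
move: hs hr; rewrite !ler_pdivrMr // -/ns -/nr => hs hr.
have ksm : ks%:R <= kmax by rewrite ler_nat leq_maxl.
have krm : kr%:R <= kmax by rewrite ler_nat leq_maxr.
rewrite expr2 [leRHS](_ : _ = (ns%:R * kmax) * (nr%:R * kmax)); last by ring.
by apply: ler_pM; rewrite ?(ltW cn0) //; [apply: le_trans hs _ | apply: le_trans hr _];
  rewrite ler_wpM2l.
Qed.

Lemma block_err_mean : Ex (block_err k k') <= L%:R * (4 * kmax ^+ 2 / (c0 * n%:R) ^+ 2).
Proof.
have sum_cst x : \sum_(l < L) x = L%:R * x :> R by rewrite sumr_const card_ord mulr_natl.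
rewrite expect_sum -sum_cst.
by apply: ler_sum => l _; exact: Bhat_mse.
Qed.

End Block.

(** * Comparison of the empirical and ideal residual matrices *)

Lemma Bhat01 (A : config n L) l k k' : 0 <= Bhat R A gs gr l k k' <= 1.
Proof.
rewrite mxE; set num := \sum_(i | _) _; set c := (_ * _)%N.
have num0 : 0 <= num by apply: sumr_ge0 => i _; apply: sumr_ge0.
rewrite divr_ge0 //=; have numc : num <= c%:R.
  apply: (@le_trans _ _ (\sum_(i | gs i == k) \sum_(j | gr j == k') 1)).
    by apply: ler_sum => i _; apply: ler_sum => j _; case: (A l i j).
  rewrite !sumr_const -mulrnA ler_nat mulnC leq_mul // subset_leq_card //;
  by apply/fintype.subsetP => i; rewrite mem_setb.
(* An empty block has average 0, since [x / 0 = 0]. *)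
case: (posnP c) => [->|c_gt0]; first by rewrite invr0 mulr0.
by rewrite ler_pdivrMr ?ltr0n // mul1r.
Qed.

(** Summing over all blocks controls every entry at once; the threshold forces the error summed over
    layers below [L * delta ^+ 2 / 2], half the lower bound for [edge_var]. *)
Definition small_err (A : config n L) : Prop :=
  \sum_k \sum_k' block_err k k' A <= L%:R * (delta ^+ 2 / 2) ^+ 2.

(** The constant of [studentized_diff_le] for [kappa = delta ^+ 2]. *)
Definition cmp_const : R := 2 * ((delta ^+ 2)^-1 + 1) ^+ 2 / delta ^+ 2.

Lemma block_err_ge0 k k' (A : config n L) : 0 <= block_err k k' A.
Proof. by apply: sumr_ge0 => l _; rewrite sqr_ge0. Qed.

Lemma residual_entry_diff (A : config n L) i j : small_err A ->
  ((Rhat R A gs gr - ideal_residual A) i j) ^+ 2 <=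
  cmp_const / n.-1%:R * block_err (gs i) (gr j) A.
Proof.
move=> sA.
have d2 : 0 < delta ^+ 2 by rewrite exprn_gt0.
have cc0 : 0 <= cmp_const by rewrite divr_ge0 ?(ltW d2) // mulr_ge0 // sqr_ge0.
have L0 : 0 < L%:R :> R by rewrite ltr0n.
have idE : ideal_residual A i j =
    (\sum_l ((A l i j)%:R - Omega B gs gr l i j)) / Num.sqrt (n.-1%:R * edge_var i j).
  by rewrite mxE sum_parallel mulr_suml.
rewrite mxE [X in _ + X]mxE idE mxE.
have [->|ne] := eqVneq i j.
  rewrite edge_var_diag mulr0 sqrtr0 invr0 mulr0 subr0 expr0n /=.
  by rewrite mulr_ge0 ?block_err_ge0 // divr_ge0 // ltW.
set be := block_err _ _ _.
(* The summed absolute error bounds the shifts of both numerator and variance; Cauchy-Schwarz over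
   the layers relates it to [be]. *)
pose d := \sum_l `|Bhat R A gs gr l (gs i) (gr j) - B l (gs i) (gr j)|.
have dbe : d ^+ 2 <= L%:R * be by have := sum_normr_sqr_le (fun l =>
  Bhat R A gs gr l (gs i) (gr j) - B l (gs i) (gr j)); rewrite card_ord.
have bes : be <= L%:R * (delta ^+ 2 / 2) ^+ 2.
  apply: le_trans sA; rewrite (bigD1 (gs i)) //= (bigD1 (gr j)) //= -/be -addrA lerDl.
  rewrite addr_ge0 //; first by apply: sumr_ge0 => *; exact: block_err_ge0.
  by apply: sumr_ge0 => k _; apply: sumr_ge0 => k' _; exact: block_err_ge0.
have d0 : 0 <= d by apply: sumr_ge0.
have OhE l : Omegahat R A gs gr l i j = Bhat R A gs gr l (gs i) (gr j).
  by rewrite /Omegahat (negbTE ne).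
have OE l : Omega B gs gr l i j = B l (gs i) (gr j) by rewrite /Omega (negbTE ne).
apply: (@le_trans _ _ (cmp_const * (d ^+ 2 / (L%:R * n.-1%:R)))).
  apply: studentized_diff_le => //.
  - apply: le_trans (ler_norm_sum _ _ _) _.
    apply: (@le_trans _ _ (\sum_(l < L) 1)); last by rewrite sumr_const card_ord.
    apply: ler_sum => l _; rewrite OhE ler_norml.
    have /andP[h0 h1] := Bhat01 A l (gs i) (gr j).
    by case: (A l i j) => /=; apply/andP; split; lra.
  - rewrite -sumrB; apply: le_trans (ler_norm_sum _ _ _) _; apply: ler_sum => l _.
    rewrite OhE OE [X in `|X|](_ : _ = B l (gs i) (gr j) - Bhat R A gs gr l (gs i) (gr j)).
      by rewrite distrC.
    by ring.
  - rewrite -sumrB; apply: le_trans (ler_norm_sum _ _ _) _; apply: ler_sum => l _.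
    rewrite OhE OE; have /andP[h0 h1] := Bhat01 A l (gs i) (gr j).
    have /andP[b0 b1] := B_bnd l (gs i) (gr j).
    set x := Bhat _ _ _ _ _ _ _ in h0 h1 *; set z := B _ _ _ in b0 b1 *.
    (* The map [x * (1 - x)] is 1-Lipschitz on the unit interval. *)
    rewrite [X in `|X|](_ : _ = (x - z) * (1 - x - z)); last by ring.
    by rewrite normrM ler_piMr // ler_norml; apply/andP; split; have := delta_gt0; lra.
  - exact: edge_var_ge.
  - rewrite -(@ler_pXn2r _ 2) ?nnegrE ?divr_ge0 ?mulr_ge0 ?(ltW delta_gt0) //.
    apply: le_trans dbe _; apply: (@le_trans _ _ (L%:R * (L%:R * (delta ^+ 2 / 2) ^+ 2))).
      by rewrite ler_wpM2l.
    by rewrite [leLHS](_ : _ = (L%:R * delta ^+ 2 / 2) ^+ 2) //; ring.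
rewrite -mulrA ler_wpM2l // ler_pdivrMr ?mulr_gt0 //.
rewrite [leRHS](_ : _ = L%:R * be) //.
by field; rewrite gt_eqF.
Qed.

Lemma residual_frob_diff (A : config n L) : small_err A ->
  frob (Rhat R A gs gr - ideal_residual A) <=
  cmp_const / n.-1%:R * \sum_i \sum_j block_err (gs i) (gr j) A.
Proof.
move=> sA; rewrite /frob mulr_sumr; apply: ler_sum => i _; rewrite mulr_sumr.
by apply: ler_sum => j _; exact: residual_entry_diff.
Qed.

(** * Probability bound for a fixed number of nodes *)

Lemma mlscbm_probE (E : config n L -> Prop) :
  mlscbm_prob B gs gr E = Ex (fun A => (`[< E A >])%:R).
Proof.
rewrite /mlscbm_prob big_mkcond; apply: eq_bigr => A _.
by rewrite mlscbm_weightE; case: ifP; rewrite ?mulr1 ?mulr0.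
Qed.

Lemma mlscbm_prob_le1 (E : config n L -> Prop) : mlscbm_prob B gs gr E <= 1.
Proof.
rewrite mlscbm_probE -[leRHS](expect_cst edge_mean); apply: expect_le.
  exact: edge_mean01.
by move=> A; case: asboolP.
Qed.

Let block_bound : R := L%:R * (4 * kmax ^+ 2 / (c0 * n%:R) ^+ 2).

Let block_bound_ge0 : 0 <= block_bound.
Proof. by rewrite mulr_ge0 // divr_ge0 ?sqr_ge0 // mulr_ge0 ?sqr_ge0. Qed.

Lemma sum_block_err_mean :
  Ex (fun A => \sum_k \sum_k' block_err k k' A) <= kmax ^+ 2 * block_bound.
Proof.
rewrite expect_sum; under eq_bigr => k _ do rewrite expect_sum.
apply: (@le_trans _ _ (\sum_(k < ks) \sum_(k' < kr) block_bound)).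
  by apply: ler_sum => k _; apply: ler_sum => k' _; exact: block_err_mean.
rewrite !sumr_const !card_ord -mulrnA -[leLHS]mulr_natl ler_wpM2r // -natrX ler_nat.
by rewrite expnS expn1 mulnC leq_mul ?leq_maxl ?leq_maxr.
Qed.

Lemma sum_entry_err_mean :
  Ex (fun A => \sum_i \sum_j block_err (gs i) (gr j) A) <= n%:R ^+ 2 * block_bound.
Proof.
rewrite expect_sum; under eq_bigr => i _ do rewrite expect_sum.
apply: (@le_trans _ _ (\sum_(i < n) \sum_(j < n) block_bound)).
  by apply: ler_sum => i _; apply: ler_sum => j _; exact: block_err_mean.
by rewrite !sumr_const !card_ord -mulrnA -[leLHS]mulr_natl -natrX.
Qed.

(** Makes the trace amenable to Markov's inequality. *)
Lemma trace_ge0 k (M : 'M[R]_n) : 0 <= \tr (altp (2 ^ k.+2) M^T).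
Proof.
have [x x1] := @exists_unit_vector R n (ltnW n_gt1).
by apply: le_trans (sqnorm_pow_le_trace k M x1); rewrite exprn_ge0 ?sqnorm_ge0.
Qed.

(** Deterministic part: the trace gives norm at most [2 + eps / 3] for the ideal matrix, and the
    Frobenius distance adds at most [eps / 3]. *)
Lemma residual_sigma1_le (A : config n L) k (eps : R) : 0 < eps -> small_err A ->
  \tr (altp (2 ^ k.+2) (ideal_residual A)^T) <= (2 + eps / 3) ^+ (2 ^ k.+2) ->
  cmp_const / n.-1%:R * \sum_i \sum_j block_err (gs i) (gr j) A <= (eps / 3) ^+ 2 ->
  sigma1 (Rhat R A gs gr) - 2 < eps.
Proof.
move=> eps0 sA trA frA.
have b0 : 0 <= 2 + eps / 3 by lra.
suff : sigma1 (Rhat R A gs gr) <= (2 + eps / 3) + eps / 3 by lra.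
apply: sigma1_le; [exact: ltnW | lra |] => x x1.
have -> : Rhat R A gs gr = ideal_residual A + (Rhat R A gs gr - ideal_residual A).
  by rewrite addrC subrK.
rewrite mulmxDl /sqnorm; under eq_bigr => i _ do rewrite mxE.
apply: sum_sqrD_le => //; first by lra.
  rewrite -/(sqnorm (ideal_residual A *m x)).
  rewrite -(@ler_pXn2r _ (2 ^ k.+1)) ?expn_gt0 ?nnegrE ?sqnorm_ge0 ?exprn_ge0 //.
  rewrite -exprM -expnS; apply: le_trans trA.
  exact: sqnorm_pow_le_trace.
apply: le_trans frA; apply: le_trans (residual_frob_diff sA).
by have := sqnorm_mulmx_le (Rhat R A gs gr - ideal_residual A) x; rewrite x1 mulr1.
Qed.

(** Union bound and Markov's inequality in one: 1 is dominated pointwise by the good indicator plus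
    five nonnegative failure terms, and expectations are taken. *)
Lemma prob_sigma1_ge a b (Mhat : config n L -> ('I_n -> 'I_a) * ('I_n -> 'I_b))
    (eps : R) k : 0 < eps ->
  1 - ((1 - mlscbm_prob B gs gr (fun A => eq_up_to_perm (Mhat A).1 gs)) +
       (1 - mlscbm_prob B gs gr (fun A => eq_up_to_perm (Mhat A).2 gr)) +
       n%:R * (growth n max_scale n.-1%:R^-1 (2 ^ k.+2) / (2 + eps / 3)) ^+ (2 ^ k.+2) +
       kmax ^+ 2 * block_bound / (L%:R * (delta ^+ 2 / 2) ^+ 2) +
       cmp_const / n.-1%:R * (n%:R ^+ 2 * block_bound) / (eps / 3) ^+ 2) <=
  mlscbm_prob B gs gr (fun A => sigma1 (Rhat R A (Mhat A).1 (Mhat A).2) - 2 < eps).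
Proof.
move=> eps0; rewrite lerBlDr.
have d2 : 0 < delta ^+ 2 / 2 by rewrite divr_gt0 ?exprn_gt0.
have cc0 : 0 <= cmp_const.
  by rewrite divr_ge0 ?sqr_ge0 // mulr_ge0 // sqr_ge0.
pose ps A : R := (`[< eq_up_to_perm (Mhat A).1 gs >])%:R.
pose pr A : R := (`[< eq_up_to_perm (Mhat A).2 gr >])%:R.
pose good A : R := (`[< sigma1 (Rhat R A (Mhat A).1 (Mhat A).2) - 2 < eps >])%:R.
pose tr A := \tr (altp (2 ^ k.+2) (ideal_residual A)^T).
pose S A := \sum_k \sum_k' block_err k k' A.
pose F A := \sum_i \sum_j block_err (gs i) (gr j) A.
pose t0 : R := (2 + eps / 3) ^+ (2 ^ k.+2).
pose s0 : R := L%:R * (delta ^+ 2 / 2) ^+ 2.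
pose f0 : R := (eps / 3) ^+ 2.
pose cf := cmp_const / n.-1%:R / f0.
have t0_gt0 : 0 < t0 by rewrite exprn_gt0 //; lra.
have s0_gt0 : 0 < s0 by rewrite mulr_gt0 ?exprn_gt0 // (lt_le_trans ltr01).
have f0_gt0 : 0 < f0 by rewrite exprn_gt0 //; lra.
have cf_ge0 : 0 <= cf.
  by apply: divr_ge0; [apply: divr_ge0 => //; apply: ltW | apply: ltW].
have Ssum : Ex S <= kmax ^+ 2 * block_bound := sum_block_err_mean.
have Fsum : Ex F <= n%:R ^+ 2 * block_bound := sum_entry_err_mean.
have Tsum : Ex tr <= n%:R * growth n max_scale n.-1%:R^-1 (2 ^ k.+2) ^+ (2 ^ k.+2).
  by apply: trace_moment; rewrite expn_gt0.
rewrite !mlscbm_probE.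
apply: (@le_trans _ _ (Ex (fun A => good A + ((1 + -1 * ps A) + (1 + -1 * pr A)
    + t0^-1 * tr A + s0^-1 * S A + cf * F A)))); last first.
  rewrite !expectD !expectZ !expect_cst !mulN1r lerD2l.
  rewrite lerD //; last first.
    rewrite [leRHS](_ : _ = cf * (n%:R ^+ 2 * block_bound)); last by rewrite /cf; ring.
    by rewrite ler_wpM2l.
  rewrite lerD //; last by rewrite mulrC ler_wpM2r // invr_ge0 ltW.
  rewrite lerD // mulrC expr_div_n mulrA ler_wpM2r // invr_ge0 ltW //.
rewrite -[leLHS](expect_cst edge_mean); apply: expect_le => [|A]; first exact: edge_mean01.
have tr0 : 0 <= tr A by exact: trace_ge0.
have S0 : 0 <= S A by do 2![apply: sumr_ge0 => ? _]; exact: block_err_ge0.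
have F0 : 0 <= F A by do 2![apply: sumr_ge0 => ? _]; exact: block_err_ge0.
have g0 : 0 <= good A by [].
have ps1 : 0 <= 1 + -1 * ps A by rewrite /ps; case: asboolP => _ /=; lra.
have pr1 : 0 <= 1 + -1 * pr A by rewrite /pr; case: asboolP => _ /=; lra.
have tr1 : 0 <= t0^-1 * tr A by rewrite mulr_ge0 ?invr_ge0 // ltW.
have S1 : 0 <= s0^-1 * S A by rewrite mulr_ge0 ?invr_ge0 // ltW.
have F1 : 0 <= cf * F A by rewrite mulr_ge0.
(* If a condition fails, its own term is already at least 1; if all five hold, the good indicator is
   1. *)
have [Hs|Hs] := asboolP (eq_up_to_perm (Mhat A).1 gs); last first.
  have : ps A = 0 by rewrite /ps; case: asboolP.
  lra.
have [Hr|Hr] := asboolP (eq_up_to_perm (Mhat A).2 gr); last first.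
  have : pr A = 0 by rewrite /pr; case: asboolP.
  lra.
have [Ht|Ht] := leP (tr A) t0; last first.
  have : 1 <= t0^-1 * tr A by rewrite ler_pdivlMl // mulr1 ltW.
  lra.
have [HS|HS] := leP (S A) s0; last first.
  have : 1 <= s0^-1 * S A by rewrite ler_pdivlMl // mulr1 ltW.
  lra.
have [HF|HF] := leP (cmp_const / n.-1%:R * F A) f0; last first.
  have : 1 <= cf * F A.
    rewrite [leRHS](_ : _ = f0^-1 * (cmp_const / n.-1%:R * F A)); last by rewrite /cf; ring.
    by rewrite ler_pdivlMl // mulr1 ltW.
  lra.
have : good A = 1.
  rewrite /good asboolT // (Rhat_perm R A Hs Hr).
  exact: (residual_sigma1_le (k := k)).
lra.
Qed.

End Model.

(** * Asymptotics *)

Lemma bernoulli_ineq (R : realType) (h : R) m : 0 <= h -> 1 + m%:R * h <= (1 + h) ^+ m.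
Proof.
move=> h0; elim: m => [|m IH]; first by rewrite expr0 mul0r addr0.
rewrite exprS -natr1; apply: (@le_trans _ _ ((1 + h) * (1 + m%:R * h))); last first.
  by rewrite ler_wpM2l // addr_ge0.
have : 0 <= m%:R * (h * h) by rewrite !mulr_ge0.
by lra.
Qed.

(** With [N = 16 * b] and [n >= b ^ 8], the terms [N ^ 3 * tau] and [N ^ 2 * K] are of order
    [b ^ -5] and [b ^ -2], and [n * tau] exceeds 1 by [1 / (n - 1)]. *)
Lemma growth_le (R : realType) (delta : R) n b : 0 < delta -> (1 < n)%N -> (0 < b)%N ->
  (b ^ 8 <= n)%N ->
  growth n (max_scale n delta) n.-1%:R^-1 (16 * b) <= 2 + (2 + 2 * 16 ^+ 3 + 2 * 16 ^+ 2 / delta) / b%:R.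
Proof.
move=> d0 n1 b0 bn; set y : R := n.-1%:R; set x : R := b%:R.
have x1 : 1 <= x by rewrite ler1n.
have x0 : 0 < x by rewrite ltr0n.
have y0 : 0 < y by rewrite ltr0n; case: (n) n1 => [|[]].
have ny : n%:R = y + 1 by rewrite natr1 prednK // ltnW.
have xy : x ^+ 8 <= 2 * y.
  have y1 : 1 <= y by rewrite ler1n; case: (n) n1 => [|[]].
  have : x ^+ 8 <= n%:R by rewrite -natrX ler_nat.
  by rewrite ny; lra.
have xn m : 1 <= x ^+ m by rewrite exprn_ege1.
have yV : y^-1 <= 2 / x ^+ 8.
  by rewrite ler_pdivlMr ?exprn_gt0 // mulrC ler_pdivrMr.
have scaleV : max_scale n delta <= 2 / (x ^+ 4 * delta).
  rewrite /max_scale -/y sqrtrM ?(ltW y0) // sqrtr_sqr (gtr0_norm d0).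
  have sy : x ^+ 4 / 2 <= Num.sqrt y.
    rewrite -(@ler_pXn2r _ 2) ?nnegrE ?sqrtr_ge0 ?divr_ge0 ?exprn_ge0 // ?(ltW x0) //.
    rewrite sqr_sqrtr ?(ltW y0) // expr_div_n -exprM; lra.
  rewrite [leRHS](_ : _ = (x ^+ 4 / 2 * delta)^-1); last first.
    by field; rewrite !gt_eqF ?exprn_gt0.
  by rewrite lef_pV2 ?posrE ?ler_pM2r // !mulr_gt0 ?invr_gt0 ?exprn_gt0 // sqrtr_gt0.
rewrite /growth ny natrM -/x.
have -> : (y + 1) * y^-1 = 1 + y^-1 by rewrite mulrDl mulfV ?mul1r // gt_eqF.
have t1 : y^-1 <= 2 / x.
  apply: le_trans yV _; rewrite ler_wpM2l // lef_pV2 ?posrE ?exprn_gt0 //.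
  by rewrite exprS -[leLHS]mulr1 ler_wpM2l // ltW.
have t2 : (16 * x) ^+ 3 * y^-1 <= 2 * 16 ^+ 3 / x.
  apply: (@le_trans _ _ ((16 * x) ^+ 3 * (2 / x ^+ 8))).
    by rewrite ler_wpM2l // exprn_ge0 // mulr_ge0 // ltW.
  rewrite [leLHS](_ : _ = 2 * 16 ^+ 3 / x / x ^+ 4); last by field; rewrite gt_eqF.
  by rewrite ler_pdivrMr ?exprn_gt0 // ler_peMr // divr_ge0 // ltW.
have t3 : (16 * x) ^+ 2 * max_scale n delta <= 2 * 16 ^+ 2 / delta / x.
  apply: (@le_trans _ _ ((16 * x) ^+ 2 * (2 / (x ^+ 4 * delta)))).
    by rewrite ler_wpM2l // exprn_ge0 // mulr_ge0 // ltW.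
  rewrite [leLHS](_ : _ = 2 * 16 ^+ 2 / delta / x / x); last by field; rewrite !gt_eqF.
  by rewrite ler_pdivrMr // ler_peMr // !divr_ge0 // ltW.
by rewrite mulrDl; lra.
Qed.

Lemma trace_term_small (R : realType) (delta eps e : R) : 0 < delta -> 0 < eps -> 0 < e ->
  exists n0, forall n, (n0 <= n)%N -> exists k,
    n%:R * (growth n (max_scale n delta) n.-1%:R^-1 (2 ^ k.+2) / (2 + eps / 3)) ^+ (2 ^ k.+2)
      <= e.
Proof.
move=> d0 eps0 e0.
(* The growth will be at most [2 + eps / 6], so its ratio to [2 + eps / 3] is at most
   [1 / (1 + h)]. *)
pose h := (2 + eps / 3) / (2 + eps / 6) - 1.
have c6 : 0 < 2 + eps / 6 by lra.
have h0 : 0 < h by rewrite subr_gt0 ltr_pdivlMr //; lra.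
(* The first summand brings the excess of the growth over 2 below [eps / 6]; the second makes the
   final bound at most [e]. *)
pose M := (Num.bound ((2 + 2 * 16 ^+ 3 + 2 * 16 ^+ 2 / delta) / (eps / 6)) + Num.bound (256 / h ^+ 16 / e)).+1.
exists (256 * M ^ 8).+2 => n nM.
(* With [b ^ 8 <= n < 256 * b ^ 8] and walks of length [16 * b], Bernoulli's
   inequality bounds [(1 + h) ^ (16 * b)] below by [(b * h) ^ 16], of order [n ^ 2]. *)
pose u := (trunc_log 2 n %/ 8)%N; pose b := (2 ^ u)%N.
(* The walk length [2 ^ k.+2] becomes [2 ^ u.+4 = 16 * b]. *)
exists u.+2.
have n1 : (1 < n)%N by apply: leq_trans nM.
have b0 : (0 < b)%N by rewrite expn_gt0.
have bn : (b ^ 8 <= n)%N.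
  rewrite /b -expnM; apply: leq_trans (trunc_logP (isT : 1 < 2)%N (ltnW n1)).
  by rewrite leq_exp2l // /u leq_trunc_div.
have nb : (n < 256 * b ^ 8)%N.
  apply: leq_trans (trunc_log_ltn n (isT : 1 < 2)%N) _.
  rewrite /b -expnM (_ : 256 = 2 ^ 8)%N // -expnD leq_exp2l // /u.
  by have := ltn_pmod (trunc_log 2 n) (isT : 0 < 8)%N; have := divn_eq (trunc_log 2 n) 8; lia.
have Mb : (M < b)%N.
  rewrite -(@ltn_exp2r _ _ 8) //.
  by rewrite -(@ltn_pmul2l 256) //; apply: leq_trans (leq_trans _ nM) (ltnW nb).
have NE : (2 ^ u.+4 = 16 * b)%N by rewrite /b !expnS; lia.
rewrite NE; set x : R := b%:R.
have x0 : 0 < x by rewrite ltr0n.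
have xM1 : (2 + 2 * 16 ^+ 3 + 2 * 16 ^+ 2 / delta) / (eps / 6) <= x.
  apply: (@le_trans _ _ (Num.bound ((2 + 2 * 16 ^+ 3 + 2 * 16 ^+ 2 / delta) / (eps / 6)))%:R).
    by apply: ltW; apply: archi_boundP; rewrite divr_ge0 ?addr_ge0 ?divr_ge0 // ltW.
  by rewrite ler_nat; move: Mb; rewrite /M; lia.
have xM2 : 256 / h ^+ 16 / e <= x.
  apply: (@le_trans _ _ (Num.bound (256 / h ^+ 16 / e))%:R).
    by apply: ltW; apply: archi_boundP; rewrite !divr_ge0 ?exprn_ge0 // ltW.
  by rewrite ler_nat; move: Mb; rewrite /M; lia.
set g := growth _ _ _ _.
have gle : g <= 2 + eps / 6.
  apply: le_trans (growth_le d0 n1 b0 bn) _; rewrite lerD2l -/x.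
  have e6 : 0 < eps / 6 by lra.
  by move: xM1; rewrite !ler_pdivrMr // (mulrC x).
have g0 : 0 <= g.
  by rewrite /g /growth !addr_ge0 ?mulr_ge0 ?exprn_ge0 ?invr_ge0 ?sqrtr_ge0.
have hE : 1 + h = (2 + eps / 3) / (2 + eps / 6) by rewrite /h addrC subrK.
have ratio : g / (2 + eps / 3) <= (1 + h)^-1.
  rewrite hE invf_div ler_pM2r // invr_gt0; lra.
have pw : (x * h) ^+ 16 <= (1 + h) ^+ (16 * b).
  rewrite mulnC exprM lerXn2r ?nnegrE ?exprn_ge0 ?mulr_ge0 // ?(ltW h0) ?(ltW x0) //; first by lra.
  by have := bernoulli_ineq b (ltW h0); rewrite -/x; lra.
have xh0 : 0 < (x * h) ^+ 16 by rewrite exprn_gt0 // mulr_gt0.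
apply: (@le_trans _ _ (n%:R * ((x * h) ^+ 16)^-1)).
  rewrite ler_wpM2l //; apply: (@le_trans _ _ ((1 + h)^-1 ^+ (16 * b))).
    rewrite lerXn2r ?nnegrE ?divr_ge0 ?invr_ge0 //; lra.
  by rewrite exprVn lef_pV2 ?posrE // (lt_le_trans xh0).
apply: (@le_trans _ _ (256 * x ^+ 8 / (x * h) ^+ 16)).
  by rewrite ler_pM2r ?invr_gt0 // -natrX -natrM ler_nat ltnW.
have x1 : 1 <= x by rewrite ler1n.
rewrite [leLHS](_ : _ = 256 / h ^+ 16 / x / x ^+ 7); last by field; rewrite !gt_eqF.
rewrite ler_pdivrMr ?exprn_gt0 //.
apply: (@le_trans _ _ e); last by rewrite ler_peMr ?exprn_ege1 // ltW.
by rewrite ler_pdivrMr // (mulrC e) -ler_pdivrMr.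
Qed.

(** Both error terms reduce to [km ^ 2 * L / n]: in the first [L] cancels and is restored using
    [L >= 1]; the 2 in the second bounds [n / (n - 1)]. *)
Lemma block_terms_le (R : realType) (n L : nat) (km c0 delta cmp eps : R) :
  (1 < n)%N -> (0 < L)%N -> 0 < c0 -> 0 < delta -> 0 <= cmp -> 0 < eps ->
  km ^+ 2 * (L%:R * (4 * km ^+ 2 / (c0 * n%:R) ^+ 2)) / (L%:R * (delta ^+ 2 / 2) ^+ 2) +
  cmp / n.-1%:R * (n%:R ^+ 2 * (L%:R * (4 * km ^+ 2 / (c0 * n%:R) ^+ 2))) / (eps / 3) ^+ 2 <=
  4 / c0 ^+ 2 / (delta ^+ 2 / 2) ^+ 2 * (km ^+ 2 * L%:R / n%:R) ^+ 2 +
  2 * (cmp * 4 / c0 ^+ 2 / (eps / 3) ^+ 2) * (km ^+ 2 * L%:R / n%:R).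
Proof.
move=> n1 L0 c00 d0 cmp0 eps0.
set zeta := km ^+ 2 * L%:R / n%:R.
set bound := L%:R * (4 * km ^+ 2 / (c0 * n%:R) ^+ 2).
have n0 : 0 < n%:R :> R by rewrite ltr0n ltnW.
have pn0 : 0 < n.-1%:R :> R by rewrite ltr0n; case: (n) n1 => [|[]].
have L1 : 1 <= L%:R :> R by rewrite ler1n.
have Lr0 : 0 < L%:R :> R by rewrite ltr0n.
have e30 : 0 < (eps / 3) ^+ 2 by rewrite exprn_gt0 //; lra.
have n2 : n%:R / n.-1%:R <= 2 :> R.
  rewrite ler_pdivrMr // -(prednK (ltnW n1)) /= -natr1.
  have : 1 <= n.-1%:R :> R by rewrite ler1n; case: (n) n1 => [|[]].
  by lra.
have km0 : 0 <= km ^+ 2 by exact: sqr_ge0.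
have z0 : 0 <= zeta by rewrite divr_ge0 ?(ltW n0) // mulr_ge0.
apply: lerD.
  have -> : km ^+ 2 * bound / (L%:R * (delta ^+ 2 / 2) ^+ 2) =
            4 / c0 ^+ 2 / (delta ^+ 2 / 2) ^+ 2 * (km ^+ 2 / n%:R) ^+ 2.
    by rewrite /bound; field; rewrite !gt_eqF.
  have c : 0 <= 4 / c0 ^+ 2 / (delta ^+ 2 / 2) ^+ 2.
    by apply: divr_ge0; [apply: divr_ge0 => //|]; exact: sqr_ge0.
  have kn0 : 0 <= km ^+ 2 / n%:R by rewrite divr_ge0 // ltW.
  rewrite ler_wpM2l // lerXn2r ?(nnegrE, kn0, z0) //.
  by rewrite /zeta ler_pM2r ?invr_gt0 // ler_peMr.
have -> : cmp / n.-1%:R * (n%:R ^+ 2 * bound) / (eps / 3) ^+ 2 =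
  (n%:R / n.-1%:R) * ((cmp * 4 / c0 ^+ 2 / (eps / 3) ^+ 2) * zeta).
  by rewrite /bound /zeta; field; rewrite !gt_eqF //.
rewrite -[leRHS]mulrA ler_wpM2r // mulr_ge0 // divr_ge0 ?sqr_ge0 // divr_ge0 ?sqr_ge0 //.
by rewrite mulr_ge0.
Qed.

Theorem theorem1 (R : realType)
  (L Ks Kr Ks0 Kr0 : nat -> nat)
  (gs : forall n, 'I_n -> 'I_(Ks n)) (gr : forall n, 'I_n -> 'I_(Kr n))
  (B : forall n, 'I_(L n) -> 'M[R]_(Ks n, Kr n))
  (Mhat : forall n, config n (L n) ->
            ('I_n -> 'I_(Ks0 n)) * ('I_n -> 'I_(Kr0 n)))
  (hL : forall n, (1 <= L n)%N)
  (* null hypothesis H0 : (Ks, Kr) = (Ks0, Kr0) *)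
  (H0 : forall n, Ks0 n = Ks n /\ Kr0 n = Kr n)
  (* Assumption 1 *)
  (A1 : exists delta : R, 0 < delta < 1 / 2 /\
          forall n (l : 'I_(L n)) (k : 'I_(Ks n)) (k' : 'I_(Kr n)),
            delta <= B n l k k' <= 1 - delta)
  (* Assumption 2 *)
  (A2 : exists c0 : R, 0 < c0 /\
          (forall n (k : 'I_(Ks n)),
             c0 * n%:R / (Ks n)%:R <= #|[set i | gs n i == k]|%:R) /\
          (forall n (k : 'I_(Kr n)),
             c0 * n%:R / (Kr n)%:R <= #|[set j | gr n j == k]|%:R))
  (* Assumption 3 *)
  (A3 : (fun n : nat => (maxn (Ks n) (Kr n))%:R ^+ 2 * (L n)%:R
                        * ln (n%:R : R) / n%:R) @ \oo --> (0 : R))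
  (* Assumption 4: M applied with inputs (Ks0, Kr0) = (Ks, Kr) is consistent *)
  (A4s : (fun n => mlscbm_prob (B n) (gs n) (gr n)
            (fun A => eq_up_to_perm (Mhat n A).1 (gs n))) @ \oo --> (1 : R))
  (A4r : (fun n => mlscbm_prob (B n) (gs n) (gr n)
            (fun A => eq_up_to_perm (Mhat n A).2 (gr n))) @ \oo --> (1 : R)) :
  forall eps : R, 0 < eps ->
    (fun n => mlscbm_prob (B n) (gs n) (gr n)
       (fun A => sigma1 (Rhat R A (Mhat n A).1 (Mhat n A).2) - 2 < eps))
      @ \oo --> (1 : R).
Proof.
move=> eps eps0.
have [delta [d01 Bbnd]] := A1.
have [c0 [c00 [sizes sizer]]] := A2.
have /andP[d0 _] := d01.
apply/cvgrPdist_lt => e e0.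
have cmp0 : 0 <= cmp_const delta.
  by apply: divr_ge0; rewrite ?sqr_ge0 // mulr_ge0 // sqr_ge0.
pose Ca : R := 4 / c0 ^+ 2 / (delta ^+ 2 / 2) ^+ 2.
pose Cb : R := 2 * (cmp_const delta * 4 / c0 ^+ 2 / (eps / 3) ^+ 2).
have Ca0 : 0 <= Ca by apply: divr_ge0; rewrite ?sqr_ge0 // divr_ge0 // sqr_ge0.
have Cb0 : 0 <= Cb.
  apply: mulr_ge0 => //; apply: divr_ge0; rewrite ?sqr_ge0 //.
  by apply: divr_ge0; rewrite ?sqr_ge0 // mulr_ge0.
(* A quarter of [e] each for sender labels, receiver labels, the trace term and the block errors. *)
have e4 : 0 < e / 4 by lra.
(* The minimum with 1 gives [zeta ^+ 2 <= zeta]; the added 1 keeps the denominator positive and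
   makes the final inequality strict. *)
pose d := Num.min 1 (e / 4 / (Ca + Cb + 1)).
have d_gt0 : 0 < d by rewrite lt_min ltr01 divr_gt0 //; lra.
have ln2 : 0 < ln (2 : R) by rewrite ln_gt0 // ltr1n.
have [n0 Htrace] := trace_term_small d0 eps0 e4.
(* Since [ln n >= ln 2] for [n >= 2], the tolerance [d * ln 2] gives [zeta <= d]. *)
have /cvgrPdist_lt/(_ _ (mulr_gt0 d_gt0 ln2)) Hz := A3.
have /cvgrPdist_lt/(_ _ e4) Hs := A4s.
have /cvgrPdist_lt/(_ _ e4) Hr := A4r.
near=> n.
have n1 : (1 < n)%N by near: n; exists 2%N.
have n_ge : (n0 <= n)%N by near: n; exists n0.
have zn : `|0 - (maxn (Ks n) (Kr n))%:R ^+ 2 * (L n)%:R * ln (n%:R : R) / n%:R| < d * ln 2.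
  by near: n.
have sn : `|1 - mlscbm_prob (B n) (gs n) (gr n)
            (fun A => eq_up_to_perm (Mhat n A).1 (gs n))| < e / 4 by near: n.
have rn : `|1 - mlscbm_prob (B n) (gs n) (gr n)
            (fun A => eq_up_to_perm (Mhat n A).2 (gr n))| < e / 4 by near: n.
have nr0 : 0 < n%:R :> R by rewrite ltr0n ltnW.
pose zeta : R := (maxn (Ks n) (Kr n))%:R ^+ 2 * (L n)%:R / n%:R.
have z0 : 0 <= zeta by rewrite divr_ge0 ?(ltW nr0) // mulr_ge0 // sqr_ge0.
have zd : zeta <= d.
  rewrite -(ler_pM2r ln2); apply: ltW; apply: le_lt_trans zn.
  rewrite sub0r normrN; apply: le_trans (ler_norm _).
  rewrite [leRHS]mulrAC -/zeta ler_wpM2l // ler_ln ?posrE ?ltr0n ?ler_nat //.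
  exact: ltnW.
have [k Hk] := Htrace n n_ge.
have lower := prob_sigma1_ge n1 (hL n) d01 (Bbnd n) c00 (sizes n) (sizer n)
  (Mhat n) k eps0.
have blocks := block_terms_le (maxn (Ks n) (Kr n))%:R n1 (hL n) c00 d0 cmp0 eps0.
have upper := mlscbm_prob_le1 (gs n) (gr n) d01 (Bbnd n)
  (fun A => sigma1 (Rhat R A (Mhat n A).1 (Mhat n A).2) - 2 < eps).
have tail : Ca * zeta ^+ 2 + Cb * zeta < e / 4.
  have zz : zeta ^+ 2 <= zeta.
    by rewrite expr2 ler_piMl // (le_trans zd) // ge_min lexx.
  have dE : d * (Ca + Cb + 1) <= e / 4.
    by rewrite -ler_pdivlMr ?ge_min ?lexx ?orbT //; lra.
  have t1 : Ca * zeta ^+ 2 <= Ca * d by rewrite ler_wpM2l // (le_trans zz).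
  have t2 : Cb * zeta <= Cb * d by rewrite ler_wpM2l.
  lra.
rewrite ger0_norm ?subr_ge0 //.
move: sn rn; rewrite !ltr_norml => /andP[_ sn] /andP[_ rn].
rewrite -/zeta -/Ca -/Cb in blocks.
lra.
Unshelve. all: by end_near.
Qed.
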